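(* Let $(M,\chi,J)$ be a compact almost Hermitian manifold of real dimension $2n$ and let $\psi\in C^\infty(M)$. (1) Assume $n\ge 2$. Let $\eta$ be an almost Hermitian metric on $(M,J)$ (identified with its positive real $(1,1)$-form), and let $W(\partial u)$ be a smooth real $(1,1)$-form depending linearly on $\partial u$. Suppose $(u_0,c)\in C^\infty(M)\times\mathbb{R}$ satisfies $$\Big(\eta+\tfrac{1}{n-1}\big((\Delta^C u_0)\chi-\sqrt{-1}\partial\bar\partial u_0\big)+W(\partial u_0)\Big)^n=e^{\psi+c}\chi^n,$$ $$\eta+\tfrac{1}{n-1}\big((\Delta^C u_0)\chi-\sqrt{-1}\partial\bar\partial u_0\big)+W(\partial u_0)>0,\qquad \sup_M u_0=0.$$ Then $$e^c=\inf_u\max_M\frac{e^{-\psi}\Big(\eta+\tfrac{1}{n-1}\big((\Delta^C u)\chi-\sqrt{-1}\partial\bar\partial u\big)+W(\partial u)\Big)^n}{\chi^n},$$ where the infimum is over all $u\in C^\infty(M)$ such that $\eta+\frac{1}{n-1}\big((\Delta^C u)\chi-\sqrt{-1}\partial\bar\partial u\big)+W(\partial u)>0$ on $M$. (2) Let $1\le k\le n$, let $\omega$ be a smooth $k$-positive real $(1,1)$-form on $(M,J)$, and let $\omega_u=\omega+\sqrt{-1}\partial\bar\partial u+Z(\partial u)$, where $Z(\partial u)$ is a smooth real $(1,1)$-form depending linearly on $\partial u$. Suppose $(u_0,c)\in C^\infty(M)\times\mathbb{R}$ satisfies $$\omega_{u_0}^k\wedge\chi^{n-k}=e^{\psi+c}\chi^n,\qquad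 \frac{\omega_{u_0}^i\wedge\chi^{n-i}}{\chi^n}>0\ \ (i=1,\dots,k),\qquad \sup_M u_0=0.$$ Then $$e^c=\inf_u\max_M\frac{e^{-\psi}\,\omega_u^k\wedge\chi^{n-k}}{\chi^n},$$ where the infimum is over all $u\in C^\infty(M)$ such that $\frac{\omega_u^i\wedge\chi^{n-i}}{\chi^n}>0$ on $M$ for $i=1,\dots,k$.
   Context: An almost Hermitian manifold $(M,\chi,J)$ is a smooth manifold $M$ with an almost complex structure $J$ (not assumed integrable) and a $J$-compatible Riemannian metric, identified with its positive real $(1,1)$-form $\chi$. The $(p,q)$-forms and the operators $\partial,\bar\partial$ are defined through the decomposition $T^{\mathbb{C}}M=T^{1,0}M\oplus T^{0,1}M$ into eigenspaces of $J$. For real $u\in C^\infty(M)$, $\sqrt{-1}\partial\bar\partial u=\frac12(dJdu)^{1,1}$ is a real $(1,1)$-form; in a local $(1,0)$-frame $(e_i)$ with dual coframe $(\theta^i)$ it equals $\sqrt{-1}\,u_{i\bar j}\,\theta^i\wedge\bar\theta^j$ with $u_{i\bar j}=e_i\bar e_j(u)-[e_i,\bar e_j]^{(0,1)}(u)$, where $(0,1)$ denotes the $(0,1)$-part. The canonical Laplacian of $\chi$ is $\Delta^C u=\mathrm{tr}_\chi(\sqrt{-1}\partial\bar\partial u)=n\,\sqrt{-1}\partial\bar\partial u\wedge\chi^{n-1}/\chi^n$. ''A smooth real $(1,1)$-form $Z(\partial u)$ depending linearly on $\partial u$'' means that $Z$ is a fixed smooth real-linear bundle map from $(1,0)$-forms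 to real $(1,1)$-forms, evaluated at $\partial u$; equivalently its local coefficients are $Z_{i\bar j}=Z_{i\bar j}^p u_p+\overline{Z_{j\bar i}^p}\,u_{\bar p}$ with $u_p=e_p(u)$, $u_{\bar p}=\bar e_p(u)$ and smooth $Z_{i\bar j}^p$. The same applies to $W$. A real $(1,1)$-form $\omega$ is $k$-positive (with respect to $\chi$) if $\omega^i\wedge\chi^{n-i}/\chi^n>0$ on $M$ for $i=1,\dots,k$. A real $(1,1)$-form is $>0$ if it is positive definite at every point. Quotients of top-degree forms by $\chi^n$ are functions on $M$. *)

(* Defs.v *)
From HB Require Import structures.
From mathcomp Require Import all_boot all_order all_algebra all_fingroup.
From mathcomp Require Import all_classical all_reals all_analysis.
From mathcomp Require Import complex ring.
Import Order.TTheory GRing.Theory Num.Theory.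
Import numFieldNormedType.Exports.

Set Implicit Arguments.
Unset Strict Implicit.
Unset Printing Implicit Defensive.

Local Open Scope classical_set_scope.
Local Open Scope ring_scope.

(** * Smooth functions on open sets of R^m *)

Definition basis_vec (R : realType) (m : nat) (i : 'I_m) : 'rV[R]_m :=
  delta_mx 0 i.

Fixpoint Ck_on (R : realType) (m k : nat) (U : set 'rV[R]_m)
    (f : 'rV[R]_m -> R) : Prop :=
  (forall x, U x -> {for x, continuous f}) /\
  match k with
  | 0 => True
  | k'.+1 => forall i : 'I_m,
      (forall x, U x -> derivable f x (basis_vec R i)) /\
      Ck_on k' U (fun x => 'D_(basis_vec R i) f x)
  end.

Definition Cinfty_on (R : realType) (m : nat) (U : set 'rV[R]_m)
    (f : 'rV[R]_m -> R) : Prop :=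
  forall k, Ck_on k U f.

(** * Smooth manifolds *)

Record chart (R : realType) (m : nat) (M : topologicalType) := Chart {
  cdom : set M ;
  cmap : M -> 'rV[R]_m ;
  cinv : 'rV[R]_m -> M ;
  cdom_open : open cdom ;
  cimg_open : open (cmap @` cdom) ;
  cmapK : forall p, cdom p -> cinv (cmap p) = p ;
  cmap_continuous : forall p, cdom p -> {for p, continuous cmap} ;
  cinv_continuous : forall x, (cmap @` cdom) x -> {for x, continuous cinv}
}.

(* [chart_at p] is a chosen chart of the atlas around [p].  Pointwise values of
   coordinate-independent expressions are computed in it. *)
Record smooth_manifold (R : realType) (m : nat) := SmoothManifold {
  mcarrier :> topologicalType ;
  mhausdorff : hausdorff_space mcarrier ;
  msecond_countable : @second_countable mcarrier ;
  midx : Type ;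
  atlas : midx -> chart R m mcarrier ;
  chart_at : mcarrier -> midx ;
  chart_at_mem : forall p, cdom (atlas (chart_at p)) p ;
  atlas_smooth : forall (a b : midx) (i : 'I_m),
    Cinfty_on (cmap (atlas a) @` (cdom (atlas a) `&` cdom (atlas b)))
      (fun x => cmap (atlas b) (cinv (atlas a) x) 0 i)
}.

Section Manifold.
Variables (R : realType) (m : nat) (M : smooth_manifold R m).

Definition mdom (a : midx M) : set M := cdom (atlas a).

Definition smooth_in (a : midx M) (f : M -> R) : Prop :=
  Cinfty_on (cmap (atlas a) @` mdom a) (f \o cinv (atlas a)).

Definition smooth (f : M -> R) : Prop := forall a, smooth_in a f.

Definition pd (a : midx M) (i : 'I_m) (f : M -> R) (p : M) : R :=
  'D_(basis_vec R i) (f \o cinv (atlas a)) (cmap (atlas a) p).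

(* Jacobian at p of the change of coordinates from chart a to chart b *)
Definition jac (a b : midx M) (p : M) : 'M[R]_m :=
  \matrix_(i, j) pd a j (fun q => cmap (atlas b) q 0 i) p.

(* Used for sup_M, and for max_M of functions that are continuous, where M is
   compact and the supremum is therefore attained. *)
Definition supM (f : M -> R) : \bar R :=
  ereal_sup [set (f p)%:E | p in [set: M]].

(** * Tensor fields

  A tensor field is given by its components in each chart of the atlas, subject
  to the usual transformation law on overlaps.  In the coordinate frame, tangent
  vectors are columns, covectors are rows, an endomorphism J acts on vectors as
  [J *m X] and on covectors (by precomposition) as [alpha *m J], and a 2-form
  Omega is the matrix with entries Omega(d_i, d_j), so that
  Omega(X, Y) = X^T *m Omega *m Y. *)

Definition components (T : Type) := midx M -> M -> T.

Definition is_almost_complex (J : components 'M[R]_m) : Prop :=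
  [/\ forall a i j, smooth_in a (fun p => J a p i j),
      forall a b p, mdom a p -> mdom b p ->
        jac a b p *m J a p = J b p *m jac a b p
    & forall a p, mdom a p -> J a p *m J a p = - 1%:M].

End Manifold.

(** * Linear algebra on one tangent space *)

Section Pointwise.
Variables (R : realType) (m : nat).
Implicit Types (J Om : 'M[R]_m).
Local Notation C := R[i].

Definition toC (p q : nat) (A : 'M[R]_(p, q)) : 'M[C]_(p, q) :=
  map_mx (fun x : R => (x%:C)%C) A.

Definition I_C : C := ('i)%C.

Definition T10 J (X : 'cV[C]_m) : Prop := toC J *m X = I_C *: X.

Definition proj10 J : 'M[C]_m := 2^-1 *: (1%:M - I_C *: toC J).
Definition proj01 J : 'M[C]_m := 2^-1 *: (1%:M + I_C *: toC J).

(* complex covectors of type (1,0), i.e. vanishing on T^{0,1} *)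
Definition covector10 J (al : 'rV[C]_m) : Prop :=
  forall X : 'cV[C]_m, toC J *m X = - I_C *: X -> al *m X = 0.

Definition part10 J (al : 'rV[R]_m) : 'rV[C]_m := toC al *m proj10 J.

(* A real 2-form of type (1,1): no (2,0)-component, hence, being real, no
   (0,2)-component either. *)
Definition form11 J Om : Prop :=
  Om^T = - Om /\
  forall X Y : 'cV[C]_m, T10 J X -> T10 J Y -> X^T *m toC Om *m Y = 0.

(* (1,1)-component of a real 2-form; see [part11_proj]. *)
Definition part11 J Om : 'M[R]_m := 2^-1 *: (Om + J^T *m Om *m J).

Definition positive11 J Om : Prop :=
  forall X : 'cV[R]_m, X != 0 -> 0 < (X^T *m Om *m (J *m X)) 0 0.

Lemma toCE p q (A : 'M[R]_(p, q)) : toC A = map_mx (real_complex R) A.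
Proof. by []. Qed.

Lemma I_C2 : I_C * I_C = -1.
Proof. by rewrite /I_C -expr2 sqr_i. Qed.

Lemma toCM p q r (A : 'M[R]_(p, q)) (B : 'M[R]_(q, r)) :
  toC (A *m B) = toC A *m toC B.
Proof. by rewrite !toCE map_mxM. Qed.

Lemma toC_inj p q : injective (@toC p q).
Proof.
move=> A B /matrixP AB; apply/matrixP => i j.
by have := AB i j; rewrite !mxE => -[].
Qed.

Lemma sandwich_expand (F : fieldType) (k : nat) (A j : 'M[F]_k) (c a b : F) :
  (c *: (1%:M + a *: j))^T *m A *m (c *: (1%:M + b *: j)) =
  (c * c) *: (A + a *: (j^T *m A) + b *: (A *m j) + (a * b) *: (j^T *m A *m j)).
Proof.
have -> : (c *: (1%:M + a *: j))^T = c *: (1%:M + a *: j^T).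
  by rewrite linearZ /= linearD /= linearZ /= trmx1.
rewrite -scalemxAr -!scalemxAl scalerA; congr (_ *: _).
rewrite mulmxDr !mulmxDl !mul1mx mulmx1 -!scalemxAl mulmx1 -!scalemxAr.
by rewrite -?scalemxAl ?scalerA !addrA.
Qed.

Lemma sandwich_mixed (F : fieldType) (k : nat) (A j : 'M[F]_k) (I : F) :
  2 != 0 :> F -> I * I = -1 ->
  (2^-1 *: (1%:M - I *: j))^T *m A *m (2^-1 *: (1%:M + I *: j)) +
  (2^-1 *: (1%:M + I *: j))^T *m A *m (2^-1 *: (1%:M - I *: j)) =
  2^-1 *: (A + j^T *m A *m j).
Proof.
move=> n2 II; rewrite -!scaleNr !sandwich_expand -scalerDr mulNr mulrN II opprK.
rewrite scale1r -scalerA; congr (_ *: _).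
apply/matrixP => p q; rewrite !mxE.
by apply: (canLR (mulKf n2)); ring.
Qed.

Lemma sandwich_same (F : fieldType) (k : nat) (A j : 'M[F]_k) (I : F) :
  2 != 0 :> F -> I * I = -1 ->
  (2^-1 *: (1%:M - I *: j))^T *m A *m (2^-1 *: (1%:M - I *: j)) = 0 ->
  A - j^T *m A *m j = I *: (j^T *m A + A *m j).
Proof.
move=> n2 II; rewrite -!scaleNr !sandwich_expand mulrNN II scaleN1r => /eqP.
rewrite scaler_eq0 mulf_eq0 !invr_eq0 orbb (negbTE n2) /= => /eqP/matrixP E.
apply/matrixP => p q; have := E p q; rewrite !mxE => H; apply/eqP.
by rewrite -subr_eq0; apply/eqP; rewrite -[RHS]H; ring.
Qed.

Lemma sandwich_eigen (F : fieldType) (k : nat) (A j : 'M[F]_k) (I : F)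
    (X Y : 'cV[F]_k) :
  2 != 0 :> F -> I * I = -1 -> j *m X = I *: X -> j *m Y = I *: Y ->
  j^T *m A *m j = A -> X^T *m A *m Y = 0.
Proof.
move=> n2 II jX jY jA.
have : (j *m X)^T *m A *m (j *m Y) = X^T *m A *m Y.
  by rewrite -[in RHS]jA trmx_mul !mulmxA.
have -> : (j *m X)^T = I *: X^T by rewrite jX linearZ.
rewrite jY -scalemxAr -!scalemxAl scalerA II scaleN1r => /eqP.
rewrite -subr_eq0 -opprD oppr_eq0 -mulr2n -scaler_nat scaler_eq0 (negbTE n2) /=.
by move/eqP.
Qed.

(* part11 J gamma (X, Y) = gamma(X^{1,0}, Y^{0,1}) + gamma(X^{0,1}, Y^{1,0}) *)
Lemma part11_proj J Om :
  toC (part11 J Om) =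
  (proj10 J)^T *m toC Om *m proj01 J + (proj01 J)^T *m toC Om *m proj10 J.
Proof.
rewrite sandwich_mixed ?pnatr_eq0 ?I_C2 // /part11 !toCE.
by rewrite map_mxZ map_mxD !map_mxM map_trmx fmorphV rmorph_nat.
Qed.

Lemma form11P J Om : J *m J = - 1%:M ->
  form11 J Om <-> Om^T = - Om /\ J^T *m Om *m J = Om.
Proof.
move=> JJ; have JJC : toC J *m toC J = - 1%:M.
  by rewrite -toCM JJ toCE map_mxN map_mx1.
split=> -[asym H]; split=> //.
  have H0 : (proj10 J)^T *m toC Om *m proj10 J = 0.
    have T x : T10 J (proj10 J *m x).
      rewrite /T10 /proj10 mulmxA scalemxAl; congr (_ *m _).
      rewrite -scalemxAr scalerA mulrC -scalerA; congr (_ *: _).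
      rewrite mulmxBr mulmx1 -scalemxAr JJC scalerBr scalerA I_C2.
      by rewrite scaleN1r opprK scalerN opprK addrC.
    apply/matrixP => i j; rewrite [RHS]mxE.
    have := H _ _ (T (delta_mx i 0)) (T (delta_mx j 0)).
    move/matrixP/(_ 0 0); rewrite [in RHS]mxE => <-.
    rewrite trmx_mul trmx_delta -!mulmxA -rowE.
    rewrite !mulmxA -colE !mxE; apply: eq_bigr => k _; rewrite !mxE.
    by congr (_ * _); apply: eq_bigr => l _; rewrite !mxE.
  have n2 : (2 : C) != 0 by rewrite pnatr_eq0.
  have /matrixP E := sandwich_same n2 I_C2 H0.
  apply/matrixP => i j; move: (E i j); rewrite !toCE map_trmx -!map_mxM.
  rewrite -map_mxB -map_mxD mxE [RHS]mxE [X in _ = _ * X]mxE.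
  move/(congr1 (@complex.Re R)); rewrite /I_C /= mul0r mulr0 subr0 !mxE => /eqP.
  by rewrite subr_eq0 => /eqP ->.
move=> X Y TX TY; apply: (sandwich_eigen _ I_C2 TX TY).
  by rewrite pnatr_eq0.
by rewrite -[in RHS]H !toCM !toCE map_trmx.
Qed.

End Pointwise.

(* The (2n)-form A_0 /\ ... /\ A_(n-1), for 2-forms A_i on R^(n+n), evaluated on
   the frame (d_0, d_n, d_1, d_(n+1), ..., d_(n-1), d_(2n-1)), with the
   convention (alpha /\ beta)(X, Y) = alpha(X) beta(Y) - alpha(Y) beta(X). *)
Definition wedge_top (R : realType) (n : nat) (A : 'I_n -> 'M[R]_(n + n)) : R :=
  (2 ^+ n)^-1 * \sum_(s : 'S_(n + n))
     (-1) ^+ s * \prod_(i < n) A i (s (lshift n i)) (s (rshift n i)).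

(* Under a change of frame all top forms scale by the same nonzero factor, so
   quotients of them do not depend on the chart. *)
Lemma wedge_top_congr (R : realType) (n : nat) (A : 'I_n -> 'M[R]_(n + n))
    (D : 'M[R]_(n + n)) :
  wedge_top (fun i => D^T *m A i *m D) = \det D * wedge_top A.
Proof.
pose f (g : {ffun 'I_n -> 'I_(n + n) * 'I_(n + n)}) (x : 'I_(n + n)) :=
  match fintype.split x with inl i => (g i).1 | inr i => (g i).2 end.
have E (B : 'M[R]_(n + n)) : wedge_top (fun i => B^T *m A i *m B) =
    (2 ^+ n)^-1 * \sum_(g : {ffun 'I_n -> 'I_(n + n) * 'I_(n + n)})
      (\prod_i A i (g i).1 (g i).2) * \det (rowsub (f g) B).
  congr (_ * _); under [RHS]eq_bigr do rewrite /determinant big_distrr /=.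
  rewrite exchange_big /=; apply: eq_bigr => s _.
  have Bi i : (B^T *m A i *m B) (s (lshift n i)) (s (rshift n i)) =
      \sum_(q : 'I_(n + n) * 'I_(n + n)) A i q.1 q.2 *
        (B q.1 (s (lshift n i)) * B q.2 (s (rshift n i))).
    rewrite mxE -(pair_bigA _ (fun k l => A i k l *
        (B k (s (lshift n i)) * B l (s (rshift n i))))) exchange_big /=.
    apply: eq_bigr => l _; rewrite mxE mulr_suml; apply: eq_bigr => k _.
    by rewrite mxE; ring.
  under eq_bigr do rewrite Bi.
  rewrite bigA_distr_bigA big_distrr /=; apply: eq_bigr => g _.
  rewrite big_split /= mulrCA; congr (_ * (_ * _)).
  rewrite big_split_ord big_split /=; congr (_ * _); apply: eq_bigr => i _;
    by rewrite mxE /f ?(unsplitK (inl i)) ?(unsplitK (inr i)).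
have -> : wedge_top A = wedge_top (fun i => 1%:M^T *m A i *m 1%:M).
  by congr wedge_top; apply: funext => i; rewrite trmx1 mul1mx mulmx1.
rewrite !E mulrCA; congr (_ * _); rewrite big_distrr /=; apply: eq_bigr => g _.
by rewrite [in LHS]rowsubE det_mulmx; ring.
Qed.

(* Om^k /\ chi^(n-k) on the same frame, for k <= n *)
Definition mixed_top (R : realType) (n k : nat) (Om chi : 'M[R]_(n + n)) : R :=
  wedge_top (fun i : 'I_n => if (i < k)%N then Om else chi).

(** * Forms on an almost complex manifold *)

Section Forms.
Variables (R : realType) (m : nat) (M : smooth_manifold R m).
Variable J : components M 'M[R]_m.
Local Notation C := R[i].

Definition is_form11 (Om : components M 'M[R]_m) : Prop :=
  [/\ forall a i j, smooth_in a (fun p => Om a p i j),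
      forall a b p, mdom a p -> mdom b p ->
        Om a p = (jac a b p)^T *m Om b p *m jac a b p
    & forall a p, mdom a p -> form11 (J a p) (Om a p)].

Definition is_positive (Om : components M 'M[R]_m) : Prop :=
  forall a p, mdom a p -> positive11 (J a p) (Om a p).

(* A J-compatible Riemannian metric g, encoded by its form
   Om(X, Y) = g(J X, Y), so that g(X, Y) = Om(X, J Y). *)
Definition is_hermitian_metric (Om : components M 'M[R]_m) : Prop :=
  is_form11 Om /\ is_positive Om.

(* A smooth real-linear bundle map from (1,0)-forms to real (1,1)-forms; the
   values of Z a p outside the covectors of type (1,0) are irrelevant. *)
Definition is_linear_form11 (Z : components M ('rV[C]_m -> 'M[R]_m)) : Prop :=
  [/\ forall a p, mdom a p -> forall (t : R) (al be : 'rV[C]_m),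
        covector10 (J a p) al -> covector10 (J a p) be ->
        Z a p ((t%:C)%C *: al + be) = t *: Z a p al + Z a p be,
      forall a p, mdom a p -> forall al : 'rV[C]_m,
        covector10 (J a p) al -> form11 (J a p) (Z a p al),
      forall a b p, mdom a p -> mdom b p -> forall al : 'rV[C]_m,
        covector10 (J b p) al ->
        Z a p (al *m toC (jac a b p)) = (jac a b p)^T *m Z b p al *m jac a b p
    & forall a (al : M -> 'rV[C]_m),
        (forall p, mdom a p -> covector10 (J a p) (al p)) ->
        (forall i, smooth_in a (fun p => complex.Re (al p 0 i))) ->
        (forall i, smooth_in a (fun p => complex.Im (al p 0 i))) ->
        forall i j, smooth_in a (fun p => Z a p (al p) i j)].

Definition du (u : M -> R) : components M 'rV[R]_m :=
  fun a p => \row_i pd a i u p.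

Definition dform1 (al : components M 'rV[R]_m) : components M 'M[R]_m :=
  fun a p => \matrix_(i, j)
    (pd a i (fun q => al a q 0 j) p - pd a j (fun q => al a q 0 i) p).

(* J acts on 1-forms by (J alpha)(X) = - alpha(J X); this is the sign for which
   sqrt(-1) partial dbar |z|^2 > 0 on C^n. *)
Definition Jform1 (al : components M 'rV[R]_m) : components M 'rV[R]_m :=
  fun a p => - (al a p *m J a p).

(* sqrt(-1) partial dbar u = 1/2 (d J d u)^{1,1} *)
Definition iddbar (u : M -> R) : components M 'M[R]_m :=
  fun a p => 2^-1 *: part11 (J a p) (dform1 (Jform1 (du u)) a p).

Definition partial (u : M -> R) : components M 'rV[C]_m :=
  fun a p => part10 (J a p) (du u a p).

End Forms.

Section AlmostHermitian.
Variables (R : realType) (n : nat) (M : smooth_manifold R (n + n)).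
Variables (J chi : components M 'M[R]_(n + n)).
Local Notation C := R[i].

(* the function (Om^k /\ chi^(n-k)) / chi^n on M *)
Definition wedge_quot (k : nat) (Om : components M 'M[R]_(n + n)) (p : M) : R :=
  let a := chart_at p in
  mixed_top k (Om a p) (chi a p) / mixed_top n (chi a p) (chi a p).

Definition k_positive (k : nat) (Om : components M 'M[R]_(n + n)) : Prop :=
  forall i : nat, (1 <= i <= k)%N -> forall p, 0 < wedge_quot i Om p.

(* Om^k /\ chi^(n-k) = f chi^n as 2n-forms *)
Definition wedge_eq (k : nat) (Om : components M 'M[R]_(n + n)) (f : M -> R) : Prop :=
  forall a p, mdom a p ->
    mixed_top k (Om a p) (chi a p) = f p * mixed_top n (chi a p) (chi a p).

Definition laplC (u : M -> R) (p : M) : R := n%:R * wedge_quot 1 (iddbar J u) p.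

(* eta + 1/(n-1) ((Lapl^C u) chi - sqrt(-1) partial dbar u) + W(partial u) *)
Definition eta_form (eta : components M 'M[R]_(n + n))
    (W : components M ('rV[C]_(n + n) -> 'M[R]_(n + n))) (u : M -> R) :
    components M 'M[R]_(n + n) :=
  fun a p => eta a p
    + (n%:R - 1)^-1 *: (laplC u p *: chi a p - iddbar J u a p)
    + W a p (partial J u a p).

(* omega + sqrt(-1) partial dbar u + Z(partial u) *)
Definition omega_form (omega : components M 'M[R]_(n + n))
    (Z : components M ('rV[C]_(n + n) -> 'M[R]_(n + n))) (u : M -> R) :
    components M 'M[R]_(n + n) :=
  fun a p => omega a p + iddbar J u a p + Z a p (partial J u a p).

End AlmostHermitian.

(* Main.v *)
Require Import Defs.
From mathcomp Require Import all_boot all_order all_algebra all_fingroup.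
From mathcomp Require Import all_classical all_reals all_analysis.
From mathcomp Require Import complex ring lra zify.
Import Order.TTheory GRing.Theory Num.Theory.
Import numFieldNormedType.Exports.

Set Implicit Arguments.
Unset Strict Implicit.
Unset Printing Implicit Defensive.

Local Open Scope classical_set_scope.
Local Open Scope ring_scope.

(* The infimum is at most e^c because u0 is admissible.  For the converse let u
   be admissible and let q be a maximum point of u0 - u.  There du = du0 and
   Hess(u - u0) >= 0, so the first-order terms agree and
   sqrt(-1) ddbar (u - u0) >= 0; hence omega_u - omega_u0 >= 0 at q, and in
   part (1) the difference is ((tr N) chi - N) / (n - 1) >= 0 for
   N = sqrt(-1) ddbar (u - u0).  In a chi-unitary frame diagonalising Om the
   quotient Om^k /\ chi^(n-k) / chi^n is the normalised k-th elementary
   symmetric function of the eigenvalues, which is monotone on the Garding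
   cone, so the quotient for u at q is at least the one for u0, namely
   e^(psi(q) + c). *)

(** * Newton's inequality and the Garding cone *)

(** The two matrices compared at [q] need not be diagonalised by a common [chi]-unitary frame, so
    their eigenvalues are matched by order: the numbers of eigenvalues above each threshold are
    compared, and the sorted lists are then dominated entry by entry. Raising one entry of a list
    changes e_k at the rate e_(k-1) of the other entries. Positivity of this rate on the Garding
    cone is where Newton's inequality enters, and it also keeps the list in the cone while entries
    are raised one after another. Part (1) uses k = n. [J] is not assumed integrable, so ddbar u
    contains first derivatives of u multiplied by derivatives of [J]; these cancel at [q] because du
    = du0 there. Smoothness is phrased through iterated coordinate derivatives, so the second
    derivative test along an arbitrary direction first needs the directional derivative in terms of
    the partial ones. *)

(** Real-rootedness, phrased as nonvanishing off the real axis. The zero polynomial is excluded,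
    which is why differentiation has the alternative of a zero derivative. *)
Definition stable_poly (R : rcfType) (p : {poly R}) : Prop :=
  forall z : R[i], complex.Im z != 0 ->
    (map_poly (real_complex R) p).[z] != 0.

Lemma Im_invc (R : rcfType) (w : R[i]) : complex.Im w != 0 ->
  complex.Im (w^-1) * complex.Im w < 0.
Proof.
case: w => a b /= b0; rewrite mulNr oppr_lt0 mulrAC -expr2.
have b2 : 0 < b ^+ 2 by rewrite lt_neqAle eq_sym sqrf_eq0 b0 sqr_ge0.
by rewrite mulr_gt0 ?invr_gt0 ?ltr_wpDl ?sqr_ge0.
Qed.

(** The logarithmic derivative is the sum of the 1/(z - x), and each term has imaginary part of sign
    opposite to that of z. The sum therefore cannot vanish, in either half-plane. *)
Lemma Im_logderiv (R : rcfType) (r : seq R[i]) (z : R[i]) :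
  complex.Im z != 0 -> (forall x, x \in r -> complex.Im x = 0) ->
  let q := \prod_(x <- r) ('X - x%:P) in
  q.[z] != 0 /\
  (r != [::] -> complex.Im (q^`().[z] / q.[z]) * complex.Im z < 0).
Proof.
move=> z0; elim: r => [|x r IH] rR /=.
  by rewrite big_nil hornerE oner_neq0.
have [q0 qlt] := IH (fun y yr => rR y (@mem_behead _ (x :: r) y yr)).
rewrite big_cons; set q := \prod_(y <- r) _ in q0 qlt *.
have x0 : complex.Im x = 0 by apply: rR; rewrite mem_head.
have Imzx : complex.Im (z - x) = complex.Im z.
  by case: (z) (x) x0 => [a b] [c d] /= ->; rewrite subr0.
have zx0 : z - x != 0.
  by apply: contraNneq z0 => zx; rewrite -Imzx zx.
split; first by rewrite !hornerE mulf_neq0.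
move=> _; rewrite derivM derivXsubC !hornerE.
have -> : (q.[z] + (z - x) * q^`().[z]) / ((z - x) * q.[z]) =
          (z - x)^-1 + q^`().[z] / q.[z] by field; rewrite zx0 q0.
have -> (u v : R[i]) : complex.Im (u + v) = complex.Im u + complex.Im v.
  by case: u; case: v.
have lt1 : complex.Im (z - x)^-1 * complex.Im z < 0.
  by rewrite -[X in _ * X]Imzx Im_invc // Imzx.
rewrite mulrDl; case: (eqVneq r [::]) => [r0|/qlt lt2].
  by rewrite /q r0 big_nil derivC !hornerE.
by rewrite -[X in _ < X]addr0; apply: ltrD lt1 lt2.
Qed.

(* Gauss-Lucas *)
Lemma stable_deriv (R : rcfType) (p : {poly R}) :
  stable_poly p -> p^`() = 0 \/ stable_poly p^`().
Proof.
move=> sp; pose P := map_poly (real_complex R) p.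
have [r] := closed_field_poly_normal P; move: (lead_coef P) => l Pr.
have rR x : x \in r -> complex.Im x = 0.
  move=> xr; apply/eqP; apply: contraT => /sp; rewrite -/P Pr hornerZ.
  have /rootP -> : root (\prod_(z <- r) ('X - z%:P)) x.
    by rewrite root_prod_XsubC.
  by rewrite mulr0 eqxx.
case: (eqVneq r [::]) => [r0|rn0].
  left; apply: (@map_poly_inj _ _ (real_complex R)).
  rewrite -deriv_map -/P Pr r0 big_nil alg_polyC derivC.
  by rewrite rmorph0.
right=> z z0; rewrite -deriv_map -/P Pr derivZ hornerZ.
have [q0 /(_ rn0)] := Im_logderiv z0 rR; move=> /= qlt.
apply: mulf_neq0.
  by have := sp z z0; rewrite -/P Pr hornerZ mulf_eq0 negb_or => /andP[].
by apply: contraTneq qlt => ->; rewrite mul0r /= mul0r ltxx.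
Qed.

Lemma stable_derivn (R : rcfType) (p : {poly R}) k :
  stable_poly p -> p^`(k) = 0 \/ stable_poly p^`(k).
Proof.
move=> sp; elim: k => [|k [IH|IH]]; first by right.
  by left; rewrite derivnS IH derivC.
by rewrite derivnS; apply: stable_deriv.
Qed.

(** Reversal turns p(z) into z^k p(1/z), and inversion preserves the nonreal numbers. If [k] exceeds
    the degree, only a power of X is gained, whose root 0 is real. *)
Lemma stable_rev (R : rcfType) (p : {poly R}) k : (size p <= k.+1)%N ->
  stable_poly p -> stable_poly (\poly_(i < k.+1) p`_(k - i)).
Proof.
move=> szp sp z z0.
have zn0 : z != 0 by apply: contraNneq z0 => ->.
have zV0 : complex.Im z^-1 != 0.
  by apply: contraTneq (Im_invc z0) => ->; rewrite mul0r ltxx.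
suff -> : (map_poly (real_complex R) (\poly_(i < k.+1) p`_(k - i))).[z] =
    z ^+ k * (map_poly (real_complex R) p).[z^-1].
  by rewrite mulf_neq0 ?expf_neq0 ?sp.
rewrite (@horner_coef_wide _ k.+1); last by rewrite size_map_poly size_poly.
rewrite (@horner_coef_wide _ k.+1 (map_poly _ p)); last by rewrite size_map_poly.
rewrite big_distrr (reindex_inj rev_ord_inj) /=; apply: eq_bigr => i _.
have ik : (i <= k)%N by rewrite -ltnS.
rewrite !coef_map coef_poly /= subSS ltnS leq_subr subKn //.
rewrite mulrCA; congr (_ * _).
have -> : z ^+ k = z ^+ (k - i) * z ^+ i by rewrite -exprD subnK.
by rewrite -mulrA -exprMn mulfV // expr1n mulr1.
Qed.

Lemma stable_quadratic (R : rcfType) (a b c : R) :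
  stable_poly (a%:P + b *: 'X + c *: 'X^2) -> 4 * a * c <= b ^+ 2.
Proof.
move=> st; rewrite leNgt; apply/negP => lt.
have c0 : c != 0.
  by apply: contraTneq lt => ->; rewrite mulr0 -leNgt sqr_ge0.
pose d := 4 * a * c - b ^+ 2; have d0 : 0 < d by rewrite subr_gt0.
pose s := Num.sqrt d; have s0 : 0 < s by rewrite sqrtr_gt0.
have s2 : s ^+ 2 = d by rewrite sqr_sqrtr // ltW.
(* A root by the quadratic formula, nonreal since the discriminant is -d < 0. *)
pose z : R[i] := Complex (- b / (2 * c)) (s / (2 * c)).
have /st : complex.Im z != 0.
  by rewrite /= mulf_neq0 ?(gt_eqF s0) ?invr_eq0 ?mulf_neq0 ?pnatr_eq0.
rewrite !rmorphD /= !map_polyZ /= map_polyX map_polyC map_polyXn /= !hornerE /z.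
rewrite (_ : _ + _ + _ = 0) ?eqxx //.
rewrite ?expr2; apply/eqP; rewrite eq_complex /= .
apply/andP; split; apply/eqP; last by field.
have -> : a = (d + b ^+ 2) / (4 * c) by rewrite /d; field.
by rewrite -s2; field.
Qed.

(** * Elementary symmetric functions and Newton's inequality *)

(** Splitting on whether the head is chosen makes [elsym (x :: s) k] affine in [x] with slope
    e_(k-1) of the tail, the form in which monotonicity is proved. *)
Fixpoint elsym (R : comNzRingType) (s : seq R) (k : nat) : R :=
  match k, s with
  | 0, _ => 1
  | _.+1, [::] => 0
  | k'.+1, x :: s' => elsym s' k + x * elsym s' k'
  end.

Lemma elsym0 (R : comNzRingType) (s : seq R) : elsym s 0 = 1.
Proof. by case: s. Qed.

Lemma elsym_over (R : comNzRingType) (s : seq R) k :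
  (size s < k)%N -> elsym s k = 0.
Proof.
by elim: s k => [|x s IH] [|k] //= sk; rewrite !IH ?mulr0 ?addr0 // ltnW.
Qed.

Lemma elsym_gen (R : comNzRingType) (s : seq R) :
  \prod_(x <- s) (1 + x *: 'X) = \poly_(i < (size s).+1) elsym s i.
Proof.
elim: s => [|x s IH].
  by apply/polyP => i; rewrite big_nil coefC coef_poly; case: i.
apply/polyP => -[|i]; rewrite big_cons IH mulrDl mul1r -scalerAl.
  by rewrite coefD coefZ coefXM mulr0 addr0 !coef_poly /= elsym0.
rewrite coefD coefZ coefXM !coef_poly /= !ltnS.
case: (ltngtP i (size s)) => [_|lt|->] //; first by rewrite mulr0 addr0.
by rewrite (elsym_over (leqnn _)) add0r.
Qed.

(* Newton's inequality, in its weak form: differentiating, reversing and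
   differentiating again the stable polynomial [\prod (1 + x X)] leaves a stable
   quadratic in three consecutive symmetric functions, whose discriminant is
   therefore nonnegative. *)
Lemma elsym_newton (R : rcfType) (s : seq R) k :
  elsym s k * elsym s k.+2 <= elsym s k.+1 ^+ 2.
Proof.
(* A nonzero e_(k+2) bounds k and guarantees that neither chain of derivatives below ends in the
   zero polynomial. *)
case: (eqVneq (elsym s k.+2) 0) => [->|E2]; first by rewrite mulr0 sqr_ge0.
have kn : (k.+2 <= size s)%N.
  by rewrite leqNgt; apply: contraNN E2 => /elsym_over ->.
(* Taking k derivatives leaves degree at most m + 2; reversing at m + 2 and differentiating m times
   leaves degree at most 2. *)
pose m := (size s - k.+2)%N; have nE : size s = (m + k.+2)%N by rewrite subnK.
pose P := \poly_(i < (size s).+1) elsym s i.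
have stP : stable_poly P.
  rewrite /P -elsym_gen => z z0; rewrite rmorph_prod horner_prod.
  rewrite prodf_seq_neq0; apply/allP => x _ /=.
  rewrite rmorphD rmorph1 /= map_polyZ map_polyX !hornerE.
  case: (z) z0 => a b /= b0; rewrite eq_complex /= !mul0r subr0 addr0 add0r.
  case: (eqVneq x 0) => [->|x0]; first by rewrite mul0r addr0 oner_eq0.
  by rewrite mulf_eq0 (negbTE x0) (negbTE b0) andbF.
have factn0 i : (i`!%:R : R) != 0 by rewrite pnatr_eq0 -lt0n fact_gt0.
have ff2 i : ((i.+2 ^_ i)%:R : R) = i.+2%:R * i.+1%:R * i`!%:R / 2.
  have := ffact_fact (leq_trans (leqnSn i) (leqnSn i.+1)).
  rewrite -addn2 addKn => /(congr1 (fun i => i%:R : R)).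
  rewrite addn2 (factS i.+1) (factS i) (_ : 2`! = 2)%N // !natrM => e.
  by apply: (canRL (mulfK _)); rewrite ?pnatr_eq0 // e mulrA.
have ff1 i : ((i.+1 ^_ i)%:R : R) = i.+1%:R * i`!%:R.
  have := ffact_fact (leqnSn i).
  by rewrite subSnn muln1 => ->; rewrite factS natrM.
have Pk i : P^`(k)`_i = (if (i <= m.+2)%N then elsym s (k + i) else 0) *
                        ((k + i) ^_ k)%:R.
  rewrite mulr_natr coef_derivn coef_poly nE.
  by rewrite (_ : (k + i < (m + k.+2).+1)%N = (i <= m.+2)%N) //; lia.
have [Pk0|stPk] := stable_derivn k stP.
  have := Pk 2; rewrite Pk0 coef0 /= addn2 ff2 => /esym/eqP.
  by rewrite !mulf_eq0 (negbTE E2) (negbTE (factn0 _)) invr_eq0 !pnatr_eq0.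
pose Q := \poly_(i < m.+3) P^`(k)`_(m.+2 - i).
have szPk : (size P^`(k)%R <= m.+3)%N.
  by apply/leq_sizeP => i mi; rewrite Pk leqNgt mi mul0r.
have stQ : stable_poly Q by apply: stable_rev.
have Qm i : (i <= 2)%N ->
    Q^`(m)`_i = elsym s (k.+2 - i) * ((k.+2 - i) ^_ k)%:R * ((m + i) ^_ m)%:R.
  move=> i2; rewrite [RHS]mulr_natr coef_derivn coef_poly -addn3 ltn_add2l ltnS i2 Pk.
  rewrite -[m.+2]addn2 subnDl (leq_trans (leq_subr _ _)) ?leq_addl //.
  by rewrite addnBA // addn2.
have Qm' i : (2 < i)%N -> Q^`(m)`_i = 0.
  by move=> i2; rewrite coef_derivn coef_poly -addn3 ltn_add2l ltnS leqNgt i2 mul0rn.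
have QE : Q^`(m) = (Q^`(m)`_0)%:P + Q^`(m)`_1 *: 'X + Q^`(m)`_2 *: 'X^2.
  apply/polyP => i; rewrite !coefD !coefZ coefC coefX coefXn.
  case: i => [|[|[|i]]] /=; rewrite ?mulr0 ?addr0 ?add0r ?mulr1 //.
  by rewrite Qm'.
have [Q0|] := stable_derivn m stQ.
  have := Qm 0%N isT; rewrite Q0 coef0 subn0 addn0 ffactnn.
  rewrite ff2 => /esym/eqP.
  by rewrite !mulf_eq0 (negbTE E2) !(negbTE (factn0 _)) invr_eq0 !pnatr_eq0.
rewrite QE => /stable_quadratic; rewrite !Qm // subn0 addn0 addn1 addn2.
rewrite subn1 (_ : k.+2 - 2 = k)%N; last by rewrite -addn2 addnK.
rewrite /= !ffactnn !ff1 !ff2.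
have := factn0 m; have := factn0 k.
have : 0 < (k`!%:R : R) by rewrite ltr0n fact_gt0.
have : 0 < (m`!%:R : R) by rewrite ltr0n fact_gt0.
move: (k`!%:R : R) (m`!%:R : R) => u v v0 u0 _ _.
rewrite -![in _ <= _]natr1.
have := ler0n R k; have := ler0n R m; move: (k%:R : R) (m%:R : R) => x y y0 x0.
move: (elsym s k) (elsym s k.+1) (elsym s k.+2) => e0 e1 e2 le.
pose w := (u * v) ^+ 2 * (x + 1) * (y + 1).
have w0 : 0 < w by rewrite !mulr_gt0 ?exprn_gt0 ?mulr_gt0 ?ltr_wpDl.
(* With x = k and y = m this is Newton's inequality with its sharp constants, after division by the
   common positive factor [w]. The weak form follows from (x + 1)(y + 1) <= (x + 2)(y + 2) when e0
   e2 > 0. *)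
have {le} : e0 * e2 * ((x + 2) * (y + 2)) <= e1 ^+ 2 * ((x + 1) * (y + 1)).
  rewrite -(ler_pM2r w0) /w; apply: le_trans (le_trans le _).
    by rewrite le_eqVlt; apply/orP; left; apply/eqP; field.
  by rewrite le_eqVlt; apply/orP; left; apply/eqP; field.
have [le0|/ltW ge0] := leP (e0 * e2) 0; first by rewrite (le_trans le0) ?sqr_ge0.
move=> le; have xy0 : 0 < (x + 1) * (y + 1) by rewrite mulr_gt0 ?ltr_wpDl.
rewrite -(ler_pM2r xy0); apply: le_trans le; rewrite ler_wpM2l //.
by rewrite ler_pM ?addr_ge0 // lerD2l ler1n.
Qed.

Lemma perm_elsym (R : comNzRingType) (s t : seq R) k :
  perm_eq s t -> elsym s k = elsym t k.
Proof.
move=> st; have : \prod_(x <- s) (1 + x *: 'X) = \prod_(x <- t) (1 + x *: 'X).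
  exact: perm_big.
rewrite !elsym_gen => /polyP/(_ k); rewrite !coef_poly (perm_size st) ltnS.
by case: leqP => // lt _; rewrite !elsym_over // (perm_size st).
Qed.

(** * Monotonicity on the Garding cone *)

Definition garding (R : numDomainType) (s : seq R) (k : nat) : Prop :=
  forall i, (1 <= i <= k)%N -> 0 < elsym s i.

(** These are the partial derivatives of e_1, ..., e_k with respect to [x]; their positivity is what
    makes e_k increasing on the cone. *)
Lemma garding_tail (R : rcfType) (x : R) (s : seq R) k i :
  garding (x :: s) k -> (i < k)%N -> 0 < elsym s i.
Proof.
elim: k i => [|k IH] i // xs ik.
have {}IH j : (j < k)%N -> 0 < elsym s j.
  by apply: IH => l /andP[l1 lk]; apply: xs; rewrite l1 ltnW.
move: ik; rewrite ltnS leq_eqVlt => /orP[/eqP->|]; last exact: IH.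
case: k xs IH => [|k] xs IH; first by rewrite elsym0.
have xk1 := xs k.+1; have := xs k.+2; rewrite leqnn => /(_ isT).
rewrite leqnSn in xk1; have {xk1} := xk1 isT; rewrite /= => e1 e2.
(* Write a = e_(k+1)(s). If a <= 0, the two positivity facts give x e_k(s) > -a >= 0 and e_k(s)
   e_(k+2)(s) > -x a e_k(s) >= a^2, contrary to Newton's inequality. *)
have e0 := IH k (leqnn _); rewrite ltNge; apply/negP => le0.
have := elsym_newton s k; rewrite leNgt => /negP; apply.
rewrite expr2; nra.
Qed.

Lemma garding_raise_head (R : rcfType) (x y : R) (s : seq R) k :
  x <= y -> garding (x :: s) k ->
  garding (y :: s) k /\ elsym (x :: s) k <= elsym (y :: s) k.
Proof.
move=> xy xs; have le i : (i <= k)%N -> elsym (x :: s) i <= elsym (y :: s) i.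
  case: i => [|i] ik //=; rewrite lerD2l ler_wpM2r // ltW //.
  exact: garding_tail xs ik.
split; last exact: le.
by move=> i /[dup] /xs i0 /andP[_ /le]; apply: lt_le_trans.
Qed.

Lemma garding_mono (R : rcfType) (s t : seq R) k :
  size s = size t -> (forall i, (i < size s)%N -> s`_i <= t`_i) ->
  garding s k -> elsym s k <= elsym t k.
Proof.
(* The prefix [p] holds the entries already raised, so each step changes a single entry of a list
   that stays in the cone. *)
suff mono p : size s = size t -> (forall i, (i < size s)%N -> s`_i <= t`_i) ->
    garding (p ++ s) k -> elsym (p ++ s) k <= elsym (p ++ t) k.
  exact: (mono [::]).
elim: s t p => [|x s IH] [|y t] p //= [szst] st ps.
have permx z : perm_eq (z :: p ++ s) (p ++ z :: s).
  by rewrite -[z :: p ++ s]cat1s perm_catCA.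
have [|ys le] := @garding_raise_head _ x y (p ++ s) k (st 0%N isT).
  by move=> i; rewrite (perm_elsym _ (permx x)); apply: ps.
rewrite -(perm_elsym _ (permx x)); apply: le_trans le _.
rewrite (perm_elsym _ (permx y)) -!cat_rcons; apply: IH => //.
  by move=> i; apply: (st i.+1).
by move=> i; rewrite cat_rcons -(perm_elsym _ (permx y)); apply: ys.
Qed.

(** * Mixed discriminants *)

(** For symmetric [A], a 2-form pairing the first half of a frame with the second. With [A] the
    identity it is the standard Hermitian form in a unitary frame (E, J E); the indices paired are
    those that [wedge_top] evaluates together. *)
Definition pairform (R : pzRingType) (n : nat) (A : 'M[R]_n) : 'M[R]_(n + n) :=
  block_mx 0 A (- A) 0.

Lemma wedge_top_eq (R : realType) (n : nat) (A B : 'I_n -> 'M[R]_(n + n)) :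
  (forall i, A i = B i) -> wedge_top A = wedge_top B.
Proof. by move=> /funext ->. Qed.

Lemma wedge_top_sum (R : realType) (n : nat) (I : finType)
    (a : 'I_n -> I -> R) (B : 'I_n -> I -> 'M[R]_(n + n)) :
  wedge_top (fun i => \sum_j a i j *: B i j) =
  \sum_(f : {ffun 'I_n -> I})
    (\prod_i a i (f i)) * wedge_top (fun i => B i (f i)).
Proof.
rewrite /wedge_top; under [RHS]eq_bigr do rewrite mulrCA.
rewrite -big_distrr /=; congr (_ * _).
under [RHS]eq_bigr do rewrite big_distrr /=.
rewrite exchange_big /=; apply: eq_bigr => s _.
under [RHS]eq_bigr do rewrite mulrCA -big_split /=.
rewrite -big_distrr /=; congr (_ * _).
rewrite -(bigA_distr_bigA (fun i j =>
  a i j * B i j (s (lshift n i)) (s (rshift n i)))).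
apply: eq_bigr => i _; rewrite summxE; apply: eq_bigr => j _.
by rewrite mxE.
Qed.

Lemma pairform_congr (R : comNzRingType) (n : nat) (D A : 'M[R]_n) :
  (block_mx D 0 0 D)^T *m pairform A *m block_mx D 0 0 D =
  pairform (D^T *m A *m D).
Proof.
rewrite /pairform tr_block_mx !trmx0 !mulmx_block.
by rewrite !(mulmx0, mul0mx, add0r, addr0) mulmxN mulNmx.
Qed.

Lemma wedge_top_pairform_congr (R : realType) (n : nat) (D : 'M[R]_n)
    (A : 'I_n -> 'M[R]_n) :
  wedge_top (fun i => pairform (D^T *m A i *m D)) =
  \det D ^+ 2 * wedge_top (fun i => pairform (A i)).
Proof.
under wedge_top_eq do rewrite -pairform_congr.
by rewrite wedge_top_congr det_ublock expr2.
Qed.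

(** Reindexing by the transposition of the two positions of slot [k] exchanges the indices of that
    factor and reverses the sign. *)
Lemma wedge_top_flip (R : realType) (n : nat) (A : 'I_n -> 'M[R]_(n + n))
    (k : 'I_n) :
  wedge_top (fun i => if i == k then (A i)^T else A i) = - wedge_top A.
Proof.
rewrite /wedge_top -mulrN; congr (_ * _); rewrite -sumrN.
set t := tperm (lshift n k) (rshift n k).
rewrite (reindex_inj (mulgI t)) /=; apply: eq_bigr => s _.
rewrite odd_permM odd_tperm eq_lrshift /= signrN mulNr.
congr (- (_ * _)); apply: eq_bigr => i _; rewrite !permM.
case: eqP => [->|/eqP ik]; first by rewrite mxE tpermL tpermR.
by rewrite !tpermD ?eq_lrshift ?eq_rlshift ?eq_lshift ?eq_rshift 1?eq_sym.
Qed.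

(** By the sign rule for transposition, [E] and [- E^T] contribute equally. Applied in every slot,
    the factors 2 cancel the normalisation (2^n)^-1. *)
Lemma wedge_top_slotB (R : realType) (n : nat) (A : 'I_n -> 'M[R]_(n + n))
    (k : 'I_n) (E : 'M[R]_(n + n)) :
  wedge_top (fun i => if i == k then E - E^T else A i) =
  2 * wedge_top (fun i => if i == k then E else A i).
Proof.
set B := fun i => if i == k then E else A i.
transitivity (wedge_top B - wedge_top (fun i => if i == k then (B i)^T else B i)).
  2: by rewrite wedge_top_flip; ring.
rewrite /wedge_top -mulrBr; congr (_ * _); rewrite -sumrB.
apply: eq_bigr => s _; rewrite -mulrBr; congr (_ * _).
rewrite (bigD1 k) //= [X in _ = X - _](bigD1 k) //=.
rewrite [X in _ = _ - X](bigD1 k) //= /B !eqxx !mxE mulrBl.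
by congr (_ * _ - _ * _); apply: eq_bigr => i /negbTE ->.
Qed.

Lemma pairform_delta (R : realType) (n : nat) (i : 'I_n) :
  pairform (delta_mx i i : 'M[R]_n) =
  delta_mx (lshift n i) (rshift n i) - (delta_mx (lshift n i) (rshift n i))^T.
Proof.
apply/matrixP => x y; rewrite /pairform trmx_delta.
case: (split_ordP x) => {}x ->; case: (split_ordP y) => {}y ->;
  rewrite ?(block_mxEul, block_mxEur, block_mxEdl, block_mxEdr) !mxE;
  by rewrite !(eq_lrshift, eq_rlshift, eq_lshift, eq_rshift)
             ?(andbF, subr0, subrr, sub0r).
Qed.

Lemma wedge_top_delta (R : realType) (n : nat) :
  wedge_top (fun i : 'I_n => pairform (delta_mx i i : 'M[R]_n)) = 1.
Proof.
pose E (i : 'I_n) : 'M[R]_(n + n) := delta_mx (lshift n i) (rshift n i).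
(* [B k] has replaced the first k skew forms by elementary matrices. At k = n only the identity
   permutation gives a nonzero product. *)
pose B k (i : 'I_n) := if (i < k)%N then E i else E i - (E i)^T.
have step k : (k < n)%N -> wedge_top (B k) = 2 * wedge_top (B k.+1).
  move=> kn; pose i0 := Ordinal kn.
  transitivity (wedge_top (fun i => if i == i0 then E i0 - (E i0)^T else B k i)).
    by apply: wedge_top_eq => i; case: eqP => // ->; rewrite /B ltnn.
  rewrite wedge_top_slotB; congr (_ * _); apply: wedge_top_eq => i.
  have -> : B k.+1 i = if (i == i0) || (i < k)%N then E i else E i - (E i)^T.
    by rewrite /B ltnS [(i <= k)%N]leq_eqVlt.
  by case: (eqVneq i i0) => [->|ne].
have all k : (k <= n)%N -> wedge_top (B 0%N) = 2 ^+ k * wedge_top (B k).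
  elim: k => [|k IH] kn; first by rewrite expr0 mul1r.
  by rewrite IH 1?ltnW // step // exprSr mulrA.
transitivity (wedge_top (B 0%N)).
  by apply: wedge_top_eq => i; rewrite pairform_delta.
rewrite (all n) // /wedge_top mulrA mulfV ?expf_neq0 ?pnatr_eq0 // mul1r.
rewrite (bigD1 1%g) //= odd_perm1 mul1r [X in X + _]big1; last first.
  by move=> i _; rewrite /B ltn_ord !perm1 mxE !eqxx.
rewrite big1 ?addr0 // => s /eqP s1; apply/eqP; rewrite mulf_eq0; apply/orP; right.
apply/negPn/negP; rewrite prodf_seq_neq0 => /allP s0; apply: s1.
apply/permP => x; rewrite perm1.
have {}s0 i : (s (lshift n i) == lshift n i) && (s (rshift n i) == rshift n i).
  have := s0 i (mem_index_enum i); rewrite /B ltn_ord mxE /=.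
  by case: (_ && _); rewrite ?eqxx.
by case: (split_ordP x) => i ->; case/andP: (s0 i) => /eqP ? /eqP.
Qed.

Lemma wedge_top_delta_perm (R : realType) (n : nat) (p : 'S_n) :
  wedge_top (fun i : 'I_n => pairform (delta_mx (p i) (p i) : 'M[R]_n)) = 1.
Proof.
transitivity (\det (perm_mx p : 'M[R]_n) ^+ 2 *
    wedge_top (fun i : 'I_n => pairform (delta_mx i i : 'M[R]_n))).
  rewrite -wedge_top_pairform_congr; apply: wedge_top_eq => i; congr pairform.
  rewrite tr_perm_mx -[p in X in _ = _ *m X]invgK -col_permE -row_permE.
  by apply/matrixP => x y; rewrite !mxE !(canF_eq (permKV p)).
by rewrite wedge_top_delta det_perm sqrr_sign mulr1.
Qed.

(** Some index j is missed by [f]. The congruence that annihilates the j-th coordinate in both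
    halves fixes every form involved, yet multiplies the top form by 0. *)
Lemma wedge_top_delta_noninj (R : realType) (n : nat) (f : {ffun 'I_n -> 'I_n}) :
  ~~ injectiveb f ->
  wedge_top (fun i : 'I_n => pairform (delta_mx (f i) (f i) : 'M[R]_n)) = 0.
Proof.
move=> ninj.
have [j jf] : exists j, j \notin codom f.
  apply/existsP; apply: contraNT ninj; rewrite negb_exists => /forallP sur.
  have /image_injP inj : #|fintype.image f 'I_n| == #|'I_n|.
    by apply/eqP/eq_card => x; have := sur x; rewrite negbK => ->.
  by apply/injectiveP => x y; apply: inj.
pose D : 'M[R]_n := diag_mx (\row_i (i != j)%:R).
transitivity (\det D ^+ 2 *
    wedge_top (fun i : 'I_n => pairform (delta_mx (f i) (f i) : 'M[R]_n))).
  rewrite -wedge_top_pairform_congr; apply: wedge_top_eq => i; congr pairform.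
  rewrite tr_diag_mx; apply/matrixP => x y.
  rewrite mul_diag_mx mul_mx_diag !mxE.
  have fj : f i != j by apply: contraNneq jf => <-; apply: codom_f.
  case: eqP => [->|_]; last by rewrite /= mulr0 mul0r.
  by case: eqP => [->|_]; rewrite /= ?fj ?mulr1 ?mul1r ?mulr0 ?mul0r.
by rewrite det_diag (bigD1 j) //= mxE eqxx mul0r expr0n mul0r.
Qed.

(** For forms diagonal in one frame the mixed discriminant becomes a permanent: noninjective choices
    of coordinates drop out and every permutation has weight 1. *)
Lemma wedge_top_diag (R : realType) (n : nat) (a : 'I_n -> 'I_n -> R) :
  wedge_top (fun i : 'I_n => pairform (diag_mx (\row_j a i j))) =
  \sum_(p : 'S_n) \prod_i a i (p i).
Proof.
have -> : wedge_top (fun i : 'I_n => pairform (diag_mx (\row_j a i j))) =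
  wedge_top (fun i => \sum_j a i j *: pairform (delta_mx j j)).
  apply: wedge_top_eq => i; rewrite diag_mx_sum_delta /pairform.
  rewrite -sumrN; apply/matrixP => x y; rewrite summxE.
  case: (split_ordP x) => {}x ->; case: (split_ordP y) => {}y ->;
  under [RHS]eq_bigr do
    rewrite mxE ?(block_mxEul, block_mxEur, block_mxEdl, block_mxEdr) !mxE;
  rewrite ?(block_mxEul, block_mxEur, block_mxEdl, block_mxEdr) ?summxE ?mxE.
  - by rewrite big1 // => j _; rewrite mulr0.
  - by apply: eq_bigr => j _; rewrite !mxE.
  - by apply: eq_bigr => j _; rewrite !mxE mulrN.
  - by rewrite big1 // => j _; rewrite mulr0.
rewrite wedge_top_sum (bigID (fun f : {ffun 'I_n -> 'I_n} => injectiveb f)) /=.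
rewrite [X in _ + X]big1 ?addr0; last first.
  by move=> f /wedge_top_delta_noninj ->; rewrite mulr0.
rewrite (reindex (fun p : 'S_n => val p)) /=; last first.
  exists (insubd (1%g : 'S_n)) => [p _|f Uf]; first by rewrite valKd.
  by rewrite insubdK.
apply: eq_big => [p|p _]; first exact: (valP p).
rewrite -[RHS]mulr1 -(wedge_top_delta_perm R p); congr (_ * _).
  by apply: eq_bigr => i _; rewrite pvalE.
by apply: wedge_top_eq => i; rewrite pvalE.
Qed.

Lemma perm_initial_segment (n k : nat) (S : {set 'I_n}) : #|S| = k ->
  exists p : 'S_n, forall i, (p i \in S) = (i < k)%N.
Proof.
move=> cS; pose e := enum S ++ enum (~: S)%SET.
have sze : size e = n.
  by rewrite size_cat -!cardE cardsC card_ord.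
have ue : uniq e.
  rewrite cat_uniq !enum_uniq andbT /=; apply/hasPn => x.
  by rewrite !mem_enum inE.
have injf : injective (fun i : 'I_n => nth i e i).
  move=> i j /eqP; rewrite (set_nth_default j) ?sze // nth_uniq ?sze //.
  by move=> /eqP/val_inj.
exists (perm injf) => i; rewrite permE nth_cat -cardE cS; case: ltnP => ik.
  by have := mem_nth i (s := enum S) (n := i); rewrite mem_enum -cardE cS => ->.
apply/negbTE; have := mem_nth i (s := enum (~: S)%SET) (n := (i - k)%N).
rewrite mem_enum inE; apply.
have := cardsC S; rewrite cS card_ord -cardE; have := ltn_ord i; lia.
Qed.

(** Both sides are the coefficient of X^k in the sum over [p] of the products of the 1 + l(p i) X.
    Each product is the same generating function, giving n! e_k; expansion over subsets gives C(n,
    k) copies of one permanent, since any k-subset can be moved to the initial segment. *)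
Lemma permanent_elsym (R : comNzRingType) (n k : nat) (l : 'I_n -> R) :
  (\sum_(p : 'S_n) \prod_(i < n) (if (i < k)%N then l (p i) else 1)) *+ 'C(n, k) =
  elsym [seq l i | i : 'I_n] k *+ n`!.
Proof.
set P := \sum_p _.
have cst (S : {set 'I_n}) : #|S| = k ->
    \sum_(p : 'S_n) \prod_i (if i \in S then l (p i) else 1) = P.
  move=> /perm_initial_segment [q qS].
  rewrite /P (reindex_inj (mulgI (q^-1)%g)) /=; apply: eq_bigr => p _.
  rewrite (reindex_inj (@perm_inj _ q)) /=; apply: eq_bigr => i _.
  by rewrite qS permM permK.
pose Q := \sum_(p : 'S_n) \prod_i (1 + l (p i) *: 'X).
have QE : Q = (\prod_(x <- [seq l i | i : 'I_n]) (1 + x *: 'X)) *+ n`!.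
  transitivity (\sum_(p : 'S_n) \prod_(x <- [seq l i | i : 'I_n]) (1 + x *: 'X)).
    2: by rewrite sumr_const card_Sn.
  apply: eq_bigr => p _; rewrite big_map big_enum /=.
  by rewrite [RHS](reindex_inj (@perm_inj _ p)).
have : Q`_k = elsym [seq l i | i : 'I_n] k *+ n`!.
  rewrite QE coefMn elsym_gen coef_poly ltnS.
  by case: leqP => // lt; rewrite elsym_over.
move=> <-; rewrite /Q coef_sum.
under eq_bigr => p _.
  under eq_bigr => i _ do rewrite addrC.
  rewrite bigA_distr coef_sum.
  under eq_bigr => S _.
    rewrite (_ : \prod_(i : 'I_n) (if i \in S then l (p i) *: 'X else 1) =
              (\prod_i (if i \in S then l (p i) else 1)) *: 'X^#|S|); last first.
      by rewrite -!big_mkcond /= scaler_prod /= prodr_const.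
    rewrite coefZ coefXn.
    over.
  over.
rewrite exchange_big /= (eq_bigr (fun S : {set 'I_n} => if #|S| == k then P else 0)).
  rewrite -big_mkcond sumr_const; congr (_ *+ _).
  by rewrite -[n in LHS]card_ord -card_draws; apply: eq_card => S; rewrite !inE.
move=> S _; rewrite -mulr_suml eq_sym.
by case: eqP => [/cst ->|_]; rewrite ?mulr1 ?mulr0.
Qed.

Lemma mixed_top_frame (R : realType) (n k : nat)
    (Om chi D : 'M[R]_(n + n)) (l : 'I_n -> R) :
  D^T *m chi *m D = pairform 1%:M ->
  D^T *m Om *m D = pairform (diag_mx (\row_j l j)) ->
  \det D * mixed_top k Om chi *+ 'C(n, k) = elsym [seq l i | i : 'I_n] k *+ n`!.
Proof.
move=> Dchi DOm; rewrite -permanent_elsym; congr (_ *+ _).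
rewrite /mixed_top -wedge_top_congr.
transitivity (wedge_top (fun i : 'I_n =>
  pairform (diag_mx (\row_j (if (i < k)%N then l j else 1))))).
  apply: wedge_top_eq => i; case: ifP => _; rewrite ?DOm ?Dchi //.
  rewrite -diag_const_mx; congr (pairform (diag_mx _)).
  by apply/rowP => j; rewrite !mxE.
by rewrite (wedge_top_diag (fun i j => if (i < k)%N then l j else 1)).
Qed.

Lemma mixed_top_quot (R : realType) (n k : nat)
    (Om chi D : 'M[R]_(n + n)) (l : 'I_n -> R) :
  (k <= n)%N ->
  D^T *m chi *m D = pairform 1%:M ->
  D^T *m Om *m D = pairform (diag_mx (\row_j l j)) ->
  mixed_top n chi chi != 0 /\
  mixed_top k Om chi / mixed_top n chi chi =
    elsym [seq l i | i : 'I_n] k / 'C(n, k)%:R.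
Proof.
move=> kn Dchi DOm; have E := mixed_top_frame k Dchi DOm.
(* For k = 0 every slot holds [chi], so this instance evaluates the denominator; dividing by it
   cancels det D and n!. *)
have := mixed_top_frame 0 Dchi DOm; rewrite elsym0 bin0 mulr1n.
have -> : mixed_top 0 Om chi = mixed_top n chi chi.
  by apply: wedge_top_eq => i /=; rewrite ltn_ord.
move=> E0.
have : \det D * mixed_top n chi chi != 0.
  by rewrite E0 pnatr_eq0 -lt0n fact_gt0.
rewrite mulf_eq0 negb_or => /andP[d0 m0]; split=> //.
have C0 : ('C(n, k)%:R : R) != 0 by rewrite pnatr_eq0 -lt0n bin_gt0.
apply/eqP; rewrite eqr_div //; apply/eqP; apply: (mulfI d0).
by rewrite mulrA mulr_natr E mulrCA E0 mulr_natr.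
Qed.

(** * Unitary frames and eigenvalues *)

Lemma posdef_unitmx (R : realFieldType) (n : nat) (G : 'M[R]_n) :
  (forall x : 'rV_n, x != 0 -> 0 < (x *m G *m x^T) 0 0) -> G \in unitmx.
Proof.
move=> Gpos; rewrite -row_free_unit -kermx_eq0.
apply: contraT => /rowV0Pn[x /sub_kermxP xG].
by move=> /Gpos; rewrite xG mul0mx mxE ltxx.
Qed.

(* A complex eigenvector exists because [R[i]] is algebraically closed;
   self-adjointness makes its eigenvalue real, so that its real and imaginary
   parts are eigenvectors too. *)
Lemma real_eigenvector (R : rcfType) (n m : nat) (G H : 'M[R]_n) (B : 'M[R]_(m, n)) :
  G^T = G -> H^T = H -> (forall x : 'rV_n, x != 0 -> 0 < (x *m G *m x^T) 0 0) ->
  (0 < m)%N -> row_free B -> stablemx B (H *m invmx G) ->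
  exists (x : 'rV[R]_n) (a : R),
    [/\ x != 0, (x <= B)%MS & x *m H = a *: (x *m G)].
Proof.
move=> Gs Hs Gpos m0 freeB /submxP[T BT]; have uG := posdef_unitmx Gpos.
have [z /eigenvalueP[w wT w0]] :=
  @eigenvalue_closed _ _ (map_mx (real_complex R) T) m0.
pose x := map_mx (@complex.Re R) w *m B; pose y := map_mx (@complex.Im R) w *m B.
have Re_mul : map_mx (@complex.Re R) (w *m map_mx (real_complex R) T) =
    map_mx (@complex.Re R) w *m T.
  apply/rowP => j; rewrite !mxE raddf_sum; apply: eq_bigr => i _; rewrite !mxE.
  by case: (w 0 i) => a b /=; rewrite mulr0 subr0.
have Im_mul : map_mx (@complex.Im R) (w *m map_mx (real_complex R) T) =
    map_mx (@complex.Im R) w *m T.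
  apply/rowP => j; rewrite !mxE raddf_sum; apply: eq_bigr => i _; rewrite !mxE.
  by case: (w 0 i) => a b /=; rewrite mulr0 add0r.
case: z wT => a b wT.
have xH : x *m H = a *: (x *m G) - b *: (y *m G).
  apply: (can_inj (mulmxKV uG)); rewrite -mulmxA mulmxBl -!scalemxAl !mulmxK //.
  rewrite /x /y -mulmxA BT mulmxA -Re_mul wT !scalemxAl -mulmxBl.
  congr (_ *m _).
  by apply/rowP => j; rewrite !mxE; case: (w 0 j) => c d /=.
have yH : y *m H = a *: (y *m G) + b *: (x *m G).
  apply: (can_inj (mulmxKV uG)); rewrite -mulmxA mulmxDl -!scalemxAl !mulmxK //.
  rewrite /x /y -mulmxA BT mulmxA -Im_mul wT !scalemxAl -mulmxDl.
  congr (_ *m _).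
  by apply/rowP => j; rewrite !mxE; case: (w 0 j) => c d /=.
have xB : (x <= B)%MS by apply: submxMl.
have yB : (y <= B)%MS by apply: submxMl.
have nn (v : 'rV[R]_n) : 0 <= (v *m G *m v^T) 0 0.
  by have [->|/Gpos/ltW //] := eqVneq v 0; rewrite mul0mx mul0mx mxE.
have xy0 : (x != 0) || (y != 0).
  rewrite -negb_and; apply: contraNN w0 => /andP[/eqP x0 /eqP y0].
  have inj0 (v : 'rV[R]_m) : v *m B = 0 -> v = 0.
    by move=> vB; apply: (row_free_inj freeB); rewrite mul0mx.
  apply/eqP/rowP => j; rewrite mxE; have /rowP/(_ j) := inj0 _ x0.
  have /rowP/(_ j) := inj0 _ y0; rewrite !mxE.
  by case: (w 0 j) => c d /= -> ->.
clearbody x y; have b0 : b = 0.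
  have sym : x *m H *m y^T = (y *m H *m x^T)^T.
    by rewrite trmx_mul trmxK trmx_mul Hs mulmxA.
  have symG : (x *m G *m y^T) 0 0 = (y *m G *m x^T) 0 0.
    have : x *m G *m y^T = (y *m G *m x^T)^T by rewrite !trmx_mul trmxK Gs mulmxA.
    by move/matrixP/(_ 0 0); rewrite [in RHS]mxE => ->.
  have /matrixP/(_ 0 0) := sym; rewrite [in RHS]mxE xH yH mulmxBl mulmxDl.
  rewrite -!scalemxAl.
  have mxD (A A' : 'M[R]_1) : (A + A') 0 0 = A 0 0 + A' 0 0 by rewrite mxE.
  have mxN (A : 'M[R]_1) : (- A) 0 0 = - A 0 0 by rewrite mxE.
  have mxZ c (A : 'M[R]_1) : (c *: A) 0 0 = c * A 0 0 by rewrite mxE.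
  rewrite !(mxD, mxN, mxZ) symG => e.
  have : b * ((x *m G *m x^T) 0 0 + (y *m G *m y^T) 0 0) = 0.
    by apply/eqP; rewrite -subr_eq0; apply/eqP; lra.
  move/eqP; rewrite mulf_eq0 => /orP[/eqP //|]; rewrite paddr_eq0 //.
  by case/orP: xy0 => /Gpos/gt_eqF ->; rewrite ?andbF.
rewrite b0 scale0r subr0 in xH; rewrite b0 scale0r addr0 in yH.
by case/orP: xy0 => ?; [exists x, a | exists y, a].
Qed.

Lemma form11_trJ (R : realType) (m : nat) (J Om : 'M[R]_m) :
  J *m J = - 1%:M -> form11 J Om -> J^T *m Om = - (Om *m J).
Proof.
move=> JJ /(form11P _ JJ)[_ JOm].
by rewrite -[Om in RHS]JOm -!mulmxA JJ !mulmxN mulmx1 opprK.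
Qed.

Lemma form11_sym (R : realType) (m : nat) (J Om : 'M[R]_m) :
  J *m J = - 1%:M -> form11 J Om -> (Om *m J)^T = Om *m J.
Proof.
move=> JJ fOm; have [Omt _] := fOm.
by rewrite trmx_mul Omt mulmxN form11_trJ // opprK.
Qed.

Lemma rank_kermx_gt0 (R : realFieldType) (n r : nat)
    (A : 'M[R]_(n, r)) : (r < n)%N -> (0 < \rank (kermx A))%N.
Proof. by move=> rn; rewrite mxrank_ker subn_gt0 (leq_ltn_trans (rank_leq_col A)). Qed.

(** The vectors orthogonal to E and J E for the metric G = chi J form a space of dimension at least
    2(n - r) > 0, stable under the operator of H = Om J relative to G. A normalised eigenvector in
    it extends the frame. *)
Lemma unitary_frame_extend (R : realType) (n r : nat)
    (J chi Om : 'M[R]_(n + n)) (E : 'M[R]_(n + n, r)) (l : 'rV[R]_r) :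
  J *m J = - 1%:M -> form11 J chi -> positive11 J chi -> form11 J Om ->
  (r < n)%N ->
  E^T *m (chi *m J) *m E = 1%:M -> E^T *m chi *m E = 0 ->
  Om *m J *m E = chi *m J *m E *m diag_mx l ->
  exists (v : 'cV[R]_(n + n)) (a : R),
    [/\ v^T *m (chi *m J) *m v = 1%:M, E^T *m (chi *m J) *m v = 0,
        E^T *m chi *m v = 0, v^T *m chi *m v = 0
      & Om *m J *m v = a *: (chi *m J *m v)].
Proof.
move=> JJ fchi chipos fOm rn E1 E2 E3.
set G := chi *m J in E1 E3 *; set H := Om *m J in E3 *.
have Gs : G^T = G by apply: form11_sym.
have Hs : H^T = H by apply: form11_sym.
have [chit _] := fchi; have [Omt _] := fOm.
have GJ : G *m J = - chi by rewrite /G -mulmxA JJ mulmxN mulmx1.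
have HJ : H *m J = - Om by rewrite /H -mulmxA JJ mulmxN mulmx1.
have JH : J^T *m H = Om.
  by rewrite mulmxA form11_trJ // mulNmx -mulmxA JJ mulmxN mulmx1 opprK.
have JG : J^T *m G = chi.
  by rewrite mulmxA form11_trJ // mulNmx -mulmxA JJ mulmxN mulmx1 opprK.
have Gpos (x : 'rV[R]_(n + n)) : x != 0 -> 0 < (x *m G *m x^T) 0 0.
  move=> x0; have := chipos x^T; rewrite trmxK /G !mulmxA; apply.
  by apply: contraNneq x0 => xt; rewrite -[x]trmxK xt trmx0.
clearbody G H; have uG := posdef_unitmx Gpos.
(* Since G J = -chi, the two blocks express orthogonality to E and to J E. *)
have rK : (0 < \rank (kermx (row_mx (G *m E) (chi *m E))))%N.
  by apply: rank_kermx_gt0; lia.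
have kA (x : 'rV[R]_(n + n)) :
    (x <= kermx (row_mx (G *m E) (chi *m E)))%MS <->
    x *m G *m E = 0 /\ x *m chi *m E = 0.
  split=> [/sub_kermxP|[x1 x2]]; last apply/sub_kermxP; rewrite mul_mx_row !mulmxA.
    by rewrite -[RHS]row_mx0 => /eq_row_mx.
  by rewrite x1 x2 row_mx0.
move: (kermx _) rK kA => K rK kA.

(* The columns of E are eigenvectors and H is J-invariant, so both orthogonality conditions survive
   the operator. *)
have stab : stablemx (row_base K) (H *m invmx G).
  rewrite (eqmx_stable _ (eq_row_base _)).
  apply/row_subP => i; rewrite row_mul; have [+ _] := kA (row i K).
  move/(_ (row_sub _ _)); move: (row i K) => x [xG xchi].
  apply/kA; split.
    by rewrite !mulmxA mulmxKV // -mulmxA E3 !mulmxA xG mul0mx.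
  rewrite -mulmxA; have -> : chi *m E = - (G *m (J *m E)).
    by rewrite mulmxA GJ mulNmx opprK.
  rewrite mulmxN !mulmxA mulmxKV //.
  have -> : x *m H *m J = - (x *m J^T *m H).
    by rewrite -mulmxA HJ mulmxN -mulmxA JH.
  rewrite mulNmx opprK -[x *m J^T *m H *m E]mulmxA E3 !mulmxA.
  by rewrite -[x *m J^T *m G]mulmxA JG xchi mul0mx.

have [x [a [x0 xA xH]]] :=
  real_eigenvector Gs Hs Gpos rK (row_base_free _) stab.
rewrite eq_row_base in xA; have /kA[xG xchi] := xA.
pose c := (x *m G *m x^T) 0 0; have c0 : 0 < c by apply: Gpos.
pose s := (Num.sqrt c)^-1; have s0 : 0 < s by rewrite invr_gt0 sqrtr_gt0.
have sc : s * s * c = 1.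
  by rewrite -expr2 /s exprVn sqr_sqrtr ?ltW // mulVf // gt_eqF.
have vt : (s *: x^T)^T = s *: x by apply/matrixP => i j; rewrite !mxE.
exists (s *: x^T), a; split.
- rewrite vt -!scalemxAl -scalemxAr scalerA.
  by apply/matrixP => i j; rewrite !ord1 [LHS]mxE -/c sc mxE eqxx.
- have -> : E^T *m G *m (s *: x^T) = s *: (x *m G *m E)^T.
    by rewrite !trmx_mul Gs mulmxA -scalemxAr.
  by rewrite xG trmx0 scaler0.
- have -> : E^T *m chi *m (s *: x^T) = - (s *: (x *m chi *m E)^T).
    by rewrite !trmx_mul chit mulNmx mulmxN scalerN opprK mulmxA -scalemxAr.
  by rewrite xchi trmx0 scaler0 oppr0.
- rewrite vt -!scalemxAl -scalemxAr scalerA.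
  suff -> : x *m chi *m x^T = 0 by rewrite scaler0.
  have : x *m chi *m x^T = - (x *m chi *m x^T)^T.
    by rewrite !trmx_mul trmxK chit mulNmx mulmxN opprK mulmxA.
  move/matrixP/(_ 0 0); rewrite [in RHS]mxE [in RHS]mxE => e.
  by apply/matrixP => i j; rewrite !ord1 [RHS]mxE; lra.
- rewrite -!scalemxAr scalerA mulrC -scalerA; congr (_ *: _).
  apply: trmx_inj; rewrite trmx_mul trmxK Hs xH linearZ /=.
  by rewrite trmx_mul trmxK Gs.
Qed.

Lemma unitary_frame_partial (R : realType) (n r : nat)
    (J chi Om : 'M[R]_(n + n)) :
  J *m J = - 1%:M -> form11 J chi -> positive11 J chi -> form11 J Om ->
  (r <= n)%N ->
  exists (E : 'M[R]_(n + n, r)) (l : 'rV[R]_r),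
  [/\ E^T *m (chi *m J) *m E = 1%:M, E^T *m chi *m E = 0 &
      Om *m J *m E = chi *m J *m E *m diag_mx l].
Proof.
move=> JJ fchi chipos fOm; elim: r => [|r IH] rn.
  by exists 0, 0; split; apply/matrixP => [] [] // ? ? [].
have [E [l [E1 E2 E3]]] := IH (ltnW rn).
have [v [a [v1 v2 v3 v4 v5]]] := unitary_frame_extend JJ fchi chipos fOm rn E1 E2 E3.
have Gs := form11_sym JJ fchi; have [chit _] := fchi.
rewrite -addn1; exists (row_mx E v), (row_mx l a%:M).
have tr3 (A : 'M[R]_(n + n)) : (v^T *m A *m E)^T = E^T *m A^T *m v.
  by rewrite !trmx_mul trmxK mulmxA.
have e2 : v^T *m (chi *m J) *m E = 0.
  by apply: trmx_inj; rewrite tr3 Gs v2 trmx0.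
have e3 : v^T *m chi *m E = 0.
  by apply: trmx_inj; rewrite tr3 chit mulmxN mulNmx v3 oppr0 trmx0.
split.
- by rewrite tr_row_mx mul_col_mx mul_col_row E1 v1 v2 e2 -scalar_mx_block.
- by rewrite tr_row_mx mul_col_mx mul_col_row E2 v4 v3 e3 block_mx0.
- rewrite !mul_mx_row diag_mx_row mul_row_block !mulmx0 addr0 add0r E3 v5.
  congr row_mx; apply/matrixP => i j.
  by rewrite !ord1 mul_mx_diag !mxE eqxx mulr1n mulrC.
Qed.

(** The frame is (E, J E), and invariance under [J] determines all blocks from those on E. The skew
    matrices [chi] and [Om] feed the top-degree computation, the symmetric [chi *m J] and [Om *m J]
    the comparison of eigenvalues, where each [l j] occurs twice. *)
Lemma unitary_frame (R : realType) (n : nat) (J chi Om : 'M[R]_(n + n)) :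
  J *m J = - 1%:M -> form11 J chi -> positive11 J chi -> form11 J Om ->
  exists (D : 'M[R]_(n + n)) (l : 'I_n -> R),
  [/\ D^T *m chi *m D = pairform 1%:M,
      D^T *m (chi *m J) *m D = 1%:M,
      D^T *m Om *m D = pairform (diag_mx (\row_j l j)) &
      D^T *m (Om *m J) *m D =
        block_mx (diag_mx (\row_j l j)) 0 0 (diag_mx (\row_j l j))].
Proof.
move=> JJ fchi chipos fOm.
have [E [l0 [E1 E2 E3]]] := unitary_frame_partial JJ fchi chipos fOm (leqnn n).
have Jinv (X : 'M[R]_(n + n)) : form11 J X ->
    let D := row_mx E (J *m E) in
    D^T *m X *m D = block_mx (E^T *m X *m E) (E^T *m (X *m J) *m E)
                      (- (E^T *m (X *m J) *m E)) (E^T *m X *m E) /\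
    D^T *m (X *m J) *m D = block_mx (E^T *m (X *m J) *m E) (- (E^T *m X *m E))
                      (E^T *m X *m E) (E^T *m (X *m J) *m E).
  move=> fX /=; have JX := form11_trJ JJ fX.
  have XJJ : X *m J *m J = - X by rewrite -mulmxA JJ mulmxN mulmx1.
  have JXJ : J^T *m X *m J = X by have [_] := (form11P _ JJ).1 fX.
  have blk A : (row_mx E (J *m E))^T *m A *m row_mx E (J *m E) =
      block_mx (E^T *m A *m E) (E^T *m (A *m J) *m E)
               (E^T *m (J^T *m A) *m E) (E^T *m (J^T *m A *m J) *m E).
    by rewrite tr_row_mx mul_col_mx mul_col_row trmx_mul !mulmxA.
  have JXJ' : J^T *m (X *m J) = X by rewrite mulmxA.
  split; rewrite blk; first by rewrite JXJ JX mulmxN mulNmx.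
  by rewrite XJJ JXJ' mulmxN mulNmx.
pose l i := l0 0 i; have lE : \row_j l j = l0 by apply/rowP => i; rewrite mxE.
have O1 : E^T *m (Om *m J) *m E = diag_mx l0.
  by rewrite -mulmxA E3 !mulmxA -[E^T *m chi *m J]mulmxA E1 mul1mx.
have O2 : E^T *m Om *m E = 0.
  have JOJ (X : 'M[R]_(n + n)) : form11 J X -> J^T *m (X *m J) = X.
    by move=> fX; rewrite mulmxA; have [_] := (form11P _ JJ).1 fX.
  rewrite -(JOJ _ fOm) -2!mulmxA E3 !mulmxA -[E^T *m J^T *m chi *m J]mulmxA.
  by rewrite -[E^T *m J^T *m (chi *m J)]mulmxA JOJ // E2 mul0mx.
have [c1 c2] := Jinv _ fchi; have [w1 w2] := Jinv _ fOm.
exists (row_mx E (J *m E)), l; rewrite lE c1 c2 w1 w2 !O1 !O2 E1 E2 oppr0.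
by rewrite -scalar_mx_block.
Qed.

(** * Weyl comparison of eigenvalues *)

(** If s_i exceeded a = t_i, then at least i + 1 entries of [s] would lie above a, but at most i
    entries of [t]. *)
Lemma sorted_count_le (R : realDomainType) (s t : seq R) :
  sorted >=%R s -> sorted >=%R t -> size s = size t ->
  (forall a, (count (> a) s <= count (> a) t)%N) ->
  forall i, (i < size s)%N -> s`_i <= t`_i.
Proof.
move=> ss st szst cst i i_s; rewrite leNgt; apply/negP => lt.
have i_t : (i < size t)%N by rewrite -szst.
have getr : transitive (>=%R : rel R) by move=> x y z /= yx zy; apply: le_trans yx.
have gerefl : reflexive (>=%R : rel R) by move=> x /=.
have nth_ge (u : seq R) : sorted >=%R u -> forall j k, (j <= k)%N ->
    (k < size u)%N -> u`_k <= u`_j.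
  move=> su j k jk ku; apply: (sorted_leq_nth getr gerefl 0 su) => //.
  by rewrite inE (leq_ltn_trans jk).
have [a ai] : exists a, a = t`_i by exists t`_i.
rewrite -ai in lt; have := cst a; rewrite leqNgt => /negP; apply.
apply: (@leq_ltn_trans i); last first.
  rewrite -(cat_take_drop i.+1 s) count_cat.
  rewrite (_ : count _ (take i.+1 s) = i.+1) ?ltnS ?leq_addr //.
  rewrite -[RHS](size_takel i_s); apply/eqP; rewrite -all_count.
  apply/(all_nthP 0) => j; rewrite size_takel // => ji; rewrite nth_take //.
  by apply: (lt_le_trans lt); apply: nth_ge.
rewrite -(cat_take_drop i t) count_cat [X in (_ + X)%N](_ : _ = 0%N) ?addn0.
  by rewrite (leq_trans (count_size _ _)) // size_takel // ltnW.
apply/eqP; rewrite -leqn0 leqNgt -has_count -all_predC.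
apply/(all_nthP 0) => j; rewrite size_drop => ji /=.
rewrite nth_drop -leNgt ai; apply: nth_ge; rewrite ?leq_addr //.
by rewrite -ltn_subRL.
Qed.

Lemma linear_system_nontrivial (R : realFieldType) (m : nat) (s : seq 'rV[R]_m) :
  (size s < m)%N ->
  exists2 X : 'cV[R]_m, X != 0 & forall r, r \in s -> r *m X = 0.
Proof.
move=> sm; pose A : 'M[R]_(m, size s) := \matrix_(i, j) (s`_j) 0 i.
have := rank_kermx_gt0 A sm; rewrite lt0n mxrank_eq0.
move=> /rowV0Pn[x /sub_kermxP xA x0]; exists x^T.
  by apply: contraNneq x0 => xt; rewrite -[x]trmxK xt trmx0.
move=> r /(nthP 0)[i i_s <-].
apply/matrixP => a b; rewrite !ord1; move/matrixP/(_ 0 (Ordinal i_s)): xA.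
rewrite !mxE => e; rewrite -[RHS]e.
by apply: eq_bigr => j _; rewrite !mxE mulrC.
Qed.

Lemma diag_pair_form (R : comNzRingType) (n : nat) (l : 'I_n -> R)
    (x : 'cV[R]_(n + n)) :
  (x^T *m block_mx (diag_mx (\row_j l j)) 0 0 (diag_mx (\row_j l j)) *m x) 0 0 =
  \sum_i l i * (x (lshift n i) 0 ^+ 2 + x (rshift n i) 0 ^+ 2).
Proof.
rewrite -[x in LHS]vsubmxK tr_col_mx mul_row_block !mulmx0 addr0 add0r mul_row_col.
rewrite mxE ![(_ *m usubmx x) 0 0]mxE ![(_ *m dsubmx x) 0 0]mxE -big_split /=.
apply: eq_bigr => i _; rewrite !mul_mx_diag !mxE; ring.
Qed.

Lemma diag_pair1 (R : pzRingType) (n : nat) : (1%:M : 'M[R]_(n + n)) =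
  block_mx (diag_mx (\row_j 1)) 0 0 (diag_mx (\row_j 1)).
Proof.
rewrite scalar_mx_block -diag_const_mx.
by congr block_mx; congr diag_mx; apply/rowP => j; rewrite !mxE.
Qed.

(* If the first count exceeded the second, a nonzero vector would lie in the
   span of the eigenvectors of [H0] with eigenvalue [> t] and in the span of
   those of [H1] with eigenvalue [<= t]. *)
Lemma weyl_count (R : realType) (n : nat) (G H0 H1 D0 D1 : 'M[R]_(n + n))
    (l0 l1 : 'I_n -> R) (t : R) :
  D0^T *m G *m D0 = 1%:M -> D1^T *m G *m D1 = 1%:M ->
  D0^T *m H0 *m D0 =
    block_mx (diag_mx (\row_j l0 j)) 0 0 (diag_mx (\row_j l0 j)) ->
  D1^T *m H1 *m D1 =
    block_mx (diag_mx (\row_j l1 j)) 0 0 (diag_mx (\row_j l1 j)) ->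
  (forall X : 'cV[R]_(n + n), (X^T *m H0 *m X) 0 0 <= (X^T *m H1 *m X) 0 0) ->
  (#|[pred i | (t < l0 i)%R]| <= #|[pred i | (t < l1 i)%R]|)%N.
Proof.
move=> G0 G1 E0 E1 le01; rewrite leqNgt; apply/negP => lt.
have uD D : D^T *m G *m D = 1%:M -> D \in unitmx.
  by move=> /mulmx1_unit[_ ->].
have u0 := uD _ G0; have u1 := uD _ G1.
pose rows (D : 'M[R]_(n + n)) (P : pred 'I_n) :=
  [seq row (lshift n i) (invmx D) | i in P] ++
  [seq row (rshift n i) (invmx D) | i in P].
(* The conditions kill the D0-coordinates with eigenvalue <= t and the D1-coordinates with
   eigenvalue > t. For counts a > b they number 2(n - a) + 2b, fewer than 2n. *)
have [|X X0 Xs] := @linear_system_nontrivial _ _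
    (rows D0 [pred i | ~~ (t < l0 i)%R] ++ rows D1 [pred i | (t < l1 i)%R]).
  rewrite /rows !size_cat !size_image.
  have := cardC [pred i | (t < l0 i)%R]; rewrite card_ord.
  have -> : #|[predC [pred i | (t < l0 i)%R]]| = #|[pred i | ~~ (t < l0 i)%R]|.
    exact: eq_card.
  move: lt; move: #|[pred i | (t < l0 i)%R]| #|[pred i | (t < l1 i)%R]| => a b.
  by move: #|_| => c; lia.
have coord D P : {subset rows D P <= rows D0 [pred i | ~~ (t < l0 i)%R] ++
                                     rows D1 [pred i | (t < l1 i)%R]} ->
    forall i, P i -> (invmx D *m X) (lshift n i) 0 = 0 /\
                     (invmx D *m X) (rshift n i) 0 = 0.
  move=> sub i Pi.
  have entry k : row k (invmx D) *m X = 0 -> (invmx D *m X) k 0 = 0.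
    by move=> /matrixP/(_ 0 0); rewrite -row_mul !mxE.
  split; apply: entry; apply: Xs; apply: sub; rewrite mem_cat; apply/orP.
    by left; apply/fintype.imageP; exists i.
  by right; apply/fintype.imageP; exists i.
have sub0 : {subset rows D0 [pred i | ~~ (t < l0 i)%R] <=
   rows D0 [pred i | ~~ (t < l0 i)%R] ++ rows D1 [pred i | (t < l1 i)%R]}.
  by move=> r; rewrite [in X in _ -> X]mem_cat => ->.
have sub1 : {subset rows D1 [pred i | (t < l1 i)%R] <=
   rows D0 [pred i | ~~ (t < l0 i)%R] ++ rows D1 [pred i | (t < l1 i)%R]}.
  by move=> r; rewrite [in X in _ -> X]mem_cat => ->; rewrite orbT.
have c0 := coord _ _ sub0; have c1 := coord _ _ sub1.
have form D M H : D \in unitmx -> D^T *m H *m D = M ->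
    X^T *m H *m X = (invmx D *m X)^T *m M *m (invmx D *m X).
  by move=> uDD <-; rewrite -[in LHS](mulKVmx uDD X) trmx_mul !mulmxA.
have := le01 X; rewrite (form _ _ _ u0 E0) (form _ _ _ u1 E1) !diag_pair_form.
apply/negP; rewrite -ltNge.
(* The squared G-norm of X, computed in both frames, links the estimates X^T H1 X <= t |X|^2 < X^T
   H0 X. *)
have : t * (X^T *m G *m X) 0 0 = t * (X^T *m G *m X) 0 0 by [].
rewrite [in LHS](form _ _ _ u1 G1) [in RHS](form _ _ _ u0 G0) diag_pair1.
rewrite !diag_pair_form.
rewrite !big_distrr /= => e.
apply: (@le_lt_trans _ _
    (\sum_i t * (1 * ((invmx D1 *m X) (lshift n i) 0 ^+ 2 +
                      (invmx D1 *m X) (rshift n i) 0 ^+ 2)))).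
  apply: ler_sum => i _; have [lti|let_] := ltP t (l1 i).
    by have [-> ->] := c1 i lti; rewrite expr0n addr0 !mulr0.
  by rewrite mul1r ler_wpM2r ?addr_ge0 ?sqr_ge0.
rewrite e -subr_gt0 -sumrB.
have pos i : 0 <= l0 i * ((invmx D0 *m X) (lshift n i) 0 ^+ 2 +
                      (invmx D0 *m X) (rshift n i) 0 ^+ 2) -
                  t * (1 * ((invmx D0 *m X) (lshift n i) 0 ^+ 2 +
                      (invmx D0 *m X) (rshift n i) 0 ^+ 2)).
  have [/ltW lti|let_] := boolP (t < l0 i).
    by rewrite mul1r subr_ge0 ler_wpM2r ?addr_ge0 ?sqr_ge0.
  by have [-> ->] := c0 i let_; rewrite expr0n addr0 !mulr0 subr0.
rewrite lt_neqAle sumr_ge0 ?andbT; last by move=> i _; apply: pos.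
apply: contraNneq X0 => /esym/eqP; rewrite psumr_eq0 => [|i _]; last exact: pos.
move=> /allP sum0; suff x0 : invmx D0 *m X = 0.
  by rewrite -(mulKVmx u0 X) x0 mulmx0.
have z i : (invmx D0 *m X) (lshift n i) 0 = 0 /\
           (invmx D0 *m X) (rshift n i) 0 = 0.
  have [lti|] := boolP (t < l0 i); last exact: c0.
  have := sum0 i (mem_index_enum i); rewrite mul1r -mulrBl mulf_eq0 subr_eq0.
  rewrite (gt_eqF lti) /= paddr_eq0 ?sqr_ge0 // !sqrf_eq0.
  by case/andP => /eqP -> /eqP ->.
apply/matrixP => i j; rewrite ord1 [RHS]mxE.
by case: (split_ordP i) => k ->; have [] := z k.
Qed.

(* Weyl monotonicity compares the ordered eigenvalues, so the diagonal case of
   Garding monotonicity applies. *)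
Lemma mixed_top_quot_mono (R : realType) (n k : nat)
    (J chi Om0 Om1 : 'M[R]_(n + n)) :
  (k <= n)%N ->
  J *m J = - 1%:M -> form11 J chi -> positive11 J chi ->
  form11 J Om0 -> form11 J Om1 ->
  (forall X : 'cV[R]_(n + n), 0 <= (X^T *m (Om1 - Om0) *m (J *m X)) 0 0) ->
  (forall i, (1 <= i <= k)%N -> 0 < mixed_top i Om0 chi / mixed_top n chi chi) ->
  mixed_top k Om0 chi / mixed_top n chi chi <=
  mixed_top k Om1 chi / mixed_top n chi chi.
Proof.
move=> kn JJ fchi chipos f0 f1 le01 gard.
have [D0 [l0 [c0 g0 d0 h0]]] := unitary_frame JJ fchi chipos f0.
have [D1 [l1 [c1 g1 d1 h1]]] := unitary_frame JJ fchi chipos f1.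
have [_ ->] := mixed_top_quot kn c0 d0; have [_ ->] := mixed_top_quot kn c1 d1.
have binpos i : (i <= n)%N -> 0 < ('C(n, i)%:R : R).
  by move=> le; rewrite ltr0n bin_gt0.
rewrite ler_pM2r ?invr_gt0 ?binpos //.
set s0 := [seq l0 i | i : 'I_n]; set s1 := [seq l1 i | i : 'I_n].
have p0 : perm_eq s0 (sort >=%R s0) by rewrite perm_sym perm_sort.
have p1 : perm_eq s1 (sort >=%R s1) by rewrite perm_sym perm_sort.
rewrite (perm_elsym _ p0) (perm_elsym _ p1).
have tot : total (>=%R : rel R) by move=> x y; apply: le_total.
have sz : size (sort >=%R s0) = size (sort >=%R s1).
  by rewrite !size_sort !size_map.
apply: garding_mono => //.
  apply: sorted_count_le; rewrite ?sort_sorted // => t.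
  rewrite !count_sort !count_map.
  have le (X : 'cV[R]_(n + n)) :
      (X^T *m (Om0 *m J) *m X) 0 0 <= (X^T *m (Om1 *m J) *m X) 0 0.
    rewrite -subr_ge0; have := le01 X; rewrite !mulmxA mulmxBr !mulmxBl.
    have mxB (A B : 'M[R]_1) : (A - B) 0 0 = A 0 0 - B 0 0 by rewrite !mxE.
    by rewrite mxB.
  have := weyl_count t g0 g1 h0 h1 le.
  by rewrite !cardE /enum_mem !size_filter.
move=> i /andP[i1 ik]; have in_ := leq_trans ik kn.
rewrite -(perm_elsym _ p0); have := gard i; rewrite i1 ik => /(_ isT).
have [_ ->] := mixed_top_quot in_ c0 d0.
by rewrite pmulr_lgt0 // invr_gt0 binpos.
Qed.

(** * Positivity and traces in a unitary frame *)

Lemma elsym1 (R : comNzRingType) (s : seq R) : elsym s 1 = \sum_(x <- s) x.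
Proof.
elim: s => [|x s IH]; first by rewrite big_nil.
by rewrite big_cons /= IH elsym0 mulr1 addrC.
Qed.

Lemma elsym_gt0 (R : numDomainType) (s : seq R) k :
  {in s, forall x, 0 < x} -> (k <= size s)%N -> 0 < elsym s k.
Proof.
elim: s k => [|x s IH] [|k] //= spos ks.
have sp : {in s, forall x, 0 < x} by move=> y ys; apply: spos; rewrite inE ys orbT.
have x0 : 0 < x by apply: spos; rewrite inE eqxx.
move: ks; rewrite ltnS leq_eqVlt => /orP[/eqP->|ks].
  by rewrite elsym_over // add0r mulr_gt0 // IH.
by rewrite addr_gt0 ?mulr_gt0 ?IH // ltnW.
Qed.

Lemma mixed_top1B (R : realType) (n : nat) (A B chi : 'M[R]_(n + n)) :
  (0 < n)%N ->
  mixed_top 1 (A - B) chi = mixed_top 1 A chi - mixed_top 1 B chi.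
Proof.
move=> n0; rewrite /mixed_top /wedge_top -mulrBr; congr (_ * _).
rewrite -sumrB; apply: eq_bigr => s _; rewrite -mulrBr; congr (_ * _).
have split0 (F : 'I_n -> R) :
    \prod_i F i = F (Ordinal n0) * \prod_(i < n | i != Ordinal n0) F i.
  by rewrite (bigD1 (Ordinal n0)).
rewrite !split0 /= !mxE mulrBl.
have tail X : \prod_(i < n | i != Ordinal n0)
    (if (i < 1)%N then X else chi) (s (lshift n i)) (s (rshift n i)) =
    \prod_(i < n | i != Ordinal n0) chi (s (lshift n i)) (s (rshift n i)).
  apply: eq_bigr => i; rewrite -val_eqE /= => i0.
  by rewrite ltnS leqn0 (negbTE i0).
by rewrite !tail.
Qed.

(** Dictionary between forms and eigenvalues: the frame vectors transfer signs to the [l i], and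
    [y i] is the squared length of the i-th complex coordinate. *)
Lemma frame_coord (R : realType) (n : nat) (G H D : 'M[R]_(n + n))
    (l : 'I_n -> R) :
  D^T *m G *m D = 1%:M ->
  D^T *m H *m D = block_mx (diag_mx (\row_j l j)) 0 0 (diag_mx (\row_j l j)) ->
  (forall i, exists2 X : 'cV[R]_(n + n), X != 0 & l i = (X^T *m H *m X) 0 0) /\
  (forall X : 'cV[R]_(n + n), exists2 y : 'I_n -> R, (forall i, 0 <= y i) &
    (X^T *m G *m X) 0 0 = \sum_i y i /\ (X^T *m H *m X) 0 0 = \sum_i l i * y i).
Proof.
move=> GD HD; have /mulmx1_unit[_ uD] := GD.
have form (X : 'cV[R]_(n + n)) M :
    (D *m X)^T *m M *m (D *m X) = X^T *m (D^T *m M *m D) *m X.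
  by rewrite trmx_mul !mulmxA.
split=> [i|X].
  exists (D *m delta_mx (lshift n i) 0).
    apply/negP => /eqP /(congr1 (mulmx (invmx D))); rewrite mulKmx // mulmx0.
    by move=> /matrixP/(_ (lshift n i) 0)/eqP; rewrite !mxE !eqxx oner_eq0.
  rewrite form HD diag_pair_form (bigD1 i) //= big1 => [|j ji].
    by rewrite !mxE !eqxx eq_rlshift /= expr1n expr0n !addr0 mulr1.
  by rewrite !mxE eq_rlshift eq_lshift (negbTE ji) /= expr0n addr0 mulr0.
pose x := invmx D *m X; have -> : X = D *m x by rewrite /x mulKVmx.
exists (fun i => x (lshift n i) 0 ^+ 2 + x (rshift n i) 0 ^+ 2).
  by move=> i; rewrite addr_ge0 ?sqr_ge0.
rewrite !form HD GD diag_pair1 !diag_pair_form; split=> //.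
by apply: eq_bigr => i _; rewrite mul1r.
Qed.

Section Unitary.
Variables (R : realType) (n : nat) (J chi : 'M[R]_(n + n)).
Hypotheses (JJ : J *m J = - 1%:M) (fchi : form11 J chi).
Hypothesis chipos : positive11 J chi.

Lemma mixed_top_metric_neq0 : mixed_top n chi chi != 0.
Proof.
have [D [l [c g d h]]] := unitary_frame JJ fchi chipos fchi.
by have [] := mixed_top_quot (leqnn n) c d.
Qed.

(** All eigenvalues are positive, hence all e_k; for k up to n this puts a positive form in the
    Garding cone used in part (1). *)
Lemma mixed_top_quot_gt0 (k : nat) (Om : 'M[R]_(n + n)) :
  form11 J Om -> positive11 J Om -> (k <= n)%N ->
  0 < mixed_top k Om chi / mixed_top n chi chi.
Proof.
move=> fOm Ompos kn.
have [D [l [c g d h]]] := unitary_frame JJ fchi chipos fOm.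
have [_ ->] := mixed_top_quot kn c d; have [lX _] := frame_coord g h.
rewrite divr_gt0 ?ltr0n ?bin_gt0 // elsym_gt0 //.
  move=> _ /mapP[i _ ->]; have [X X0 ->] := lX i.
  by have := Ompos X X0; rewrite !mulmxA.
by rewrite size_map -cardE card_ord.
Qed.

Lemma trace_form_ge0 (N : 'M[R]_(n + n)) :
  (0 < n)%N -> form11 J N ->
  (forall X : 'cV[R]_(n + n), 0 <= (X^T *m N *m (J *m X)) 0 0) ->
  let tr := n%:R * (mixed_top 1 N chi / mixed_top n chi chi) in
  forall X : 'cV[R]_(n + n), 0 <= (X^T *m (tr *: chi - N) *m (J *m X)) 0 0.
Proof.
move=> n0 fN Npos tr X.
have [D [l [c g d h]]] := unitary_frame JJ fchi chipos fN.
have [lX /(_ X)[y y0 [Gy Ny]]] := frame_coord g h.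
have l0 i : 0 <= l i.
  by have [Y _ ->] := lX i; have := Npos Y; rewrite !mulmxA.
have trE : tr = \sum_i l i.
  rewrite /tr; have [_ ->] := mixed_top_quot n0 c d.
  by rewrite bin1 mulrC mulfVK ?pnatr_eq0 -?lt0n // elsym1 big_map big_enum.
have -> : (X^T *m (tr *: chi - N) *m (J *m X)) 0 0 =
    tr * (X^T *m (chi *m J) *m X) 0 0 - (X^T *m (N *m J) *m X) 0 0.
  rewrite mulmxBr mulmxBl -scalemxAr -scalemxAl !mulmxA.
  by rewrite mxE [X in X + _]mxE [X in _ + X]mxE.
rewrite Gy Ny big_distrr /= -sumrB sumr_ge0 // => i _.
(* The i-th eigenvalue of tr chi - N is the sum of the [l j] with j different from i. *)
rewrite -mulrBl mulr_ge0 // trE (bigD1 i) //= addrAC subrr add0r.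
by apply: sumr_ge0.
Qed.

End Unitary.

(** * The maximum principle *)

Lemma is_derive_along (R : realType) (m : nat) (f : 'rV[R]_m -> R)
    (p e : 'rV[R]_m) (t d : R) :
  is_derive (p + t *: e) e f d -> is_derive t 1 (fun s : R => f (p + s *: e)) d.
Proof.
move=> [df dE].
have E : (fun h : R => h^-1 *: (((fun s : R => f (p + s *: e)) \o shift t)
             (h *: 1) - f (p + t *: e))) =
    (fun h => h^-1 *: ((f \o shift (p + t *: e)) (h *: e) - f (p + t *: e))).
  apply: funext => h /=; congr (_ *: (f _ - _)).
  by rewrite [_%:A]mulr1 scalerDl addrCA addrA.
by apply: DeriveDef; rewrite /derivable /derive E.
Qed.

Lemma mean_value_line (R : realType) (m : nat) (f : 'rV[R]_m -> R)
    (p e : 'rV[R]_m) (a : R) :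
  (forall t : R, `|t| <= `|a| -> derivable f (p + t *: e) e) ->
  exists2 t, `|t| <= `|a| & f (p + a *: e) - f p = a * 'D_e f (p + t *: e).
Proof.
(* Parametrising the segment by [0, 1] handles both signs of [a]. *)
move=> df; pose g (s : R) := f (p + (s * a) *: e).
pose dg (s : R) := 'D_e f (p + (s * a) *: e) * a.
have le (s : R) : s \in `[0, 1]%R -> `|s * a| <= `|a|.
  rewrite in_itv /= => /andP[s0 s1].
  by rewrite normrM ger0_norm // ler_piMl.
have gd (s : R) : s \in `[0, 1]%R -> is_derive s 1 g (dg s).
  move=> s01; apply: (@is_derive1_comp _ (fun s => f (p + s *: e)) ( *%R^~ a)).
    by apply: is_derive_along; apply: derivableP; apply: df; apply: le.
  have -> : ( *%R^~ a) = a \*: (id : R -> R).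
    by apply: funext => x /=; rewrite mulrC.
  by rewrite -[X in is_derive _ _ _ X]mulr1; apply: is_deriveZ.
have gd' (s : R) : s \in `]0, 1[%R -> is_derive s 1 g (dg s).
  by rewrite in_itv /= => /andP[s0 s1]; apply: gd; rewrite in_itv /= !ltW.
have gc : {within `[0, 1], continuous g}.
  by apply: derivable_within_continuous => s /gd[].
have [s s01] := MVT_segment ler01 gd' gc.
rewrite /g /dg mul1r mul0r scale0r addr0 subr0 mulr1 mulrC => ->.
by exists (s * a) => //; apply: le.
Qed.

Lemma mx_norm_le (R : realType) (m n : nat) (A : 'M[R]_(m, n)) (c : R) :
  0 <= c -> (forall i j, `|A i j| <= c) -> `|A| <= c.
Proof.
move=> c0 Ac; rewrite [leLHS]/Num.Def.normr /= mx_normrE.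
by apply: bigmax_le => // -[i j] _.
Qed.

Lemma mx_coord_le (R : realType) (m n : nat) (A : 'M[R]_(m, n)) i j :
  `|A i j| <= `|A|.
Proof.
rewrite [leRHS]/Num.Def.normr /= mx_normrE.
by apply/bigmax_geP; right => /=; exists (i, j).
Qed.

(* Telescoping over the coordinates and applying the mean value theorem on
   each segment reduces a directional increment to values of the partial
   derivatives near the base point. *)
Lemma is_derive_partials (R : realType) (m : nat) (U : set 'rV[R]_m)
    (f : 'rV[R]_m -> R) (x v : 'rV[R]_m) :
  open U -> U x -> Ck_on 1 U f ->
  is_derive x v f (\sum_i v 0 i * 'D_(basis_vec R i) f x).
Proof.
move=> oU Ux [_ fU]; set l := \sum_i _.
pose w (h : R) k : 'rV[R]_m := \row_i (if (i < k)%N then h * v 0 i else 0).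
have cvg_l : h^-1 *: ((f \o shift x) (h *: v) - f x) @[h --> 0^'] --> l.
  apply/cvgrPdist_le => eps eps0.
  pose S := \sum_i `|v 0 i| + 1.
  have S0 : 0 < S by rewrite ltr_wpDl ?sumr_ge0.
  pose e1 := eps / S; have e10 : 0 < e1 by rewrite divr_gt0.
  have : \forall y \near x, U y /\ forall i : 'I_m,
      `|'D_(basis_vec R i) f x - 'D_(basis_vec R i) f y| <= e1.
    apply: filterI; first exact: open_nbhs_nbhs.
    apply: (@filter_forall _ _ (fun (i : 'I_m) y =>
      `|'D_(basis_vec R i) f x - 'D_(basis_vec R i) f y| <= e1)
      (nbhs x) (nbhs_filter x)) => i.
    have [_ [/(_ _ Ux) cD _]] := fU i.
    have cD' : 'D_(basis_vec R i) f y @[y --> x] --> 'D_(basis_vec R i) f x := cD.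
    by have /cvgrPdist_le/(_ _ e10) := cD'.
  move=> /nbhs_ballP[d /= d0 xd].
  have ball_of (y : 'rV[R]_m) : `|y| < d -> ball x d (x + y).
    by move=> yd; rewrite -ball_normE /= opprD addrA subrr sub0r normrN.
  pose d1 := d / (`|v| + 1).
  have d10 : 0 < d1 by rewrite divr_gt0 // ltr_wpDl.
  have near_h : \forall h \near (0 : R)^', h != 0 /\ `|h| < d1.
    near=> h; split; near: h; first exact: nbhs_dnbhs_neq.
    exact: dnbhs0_lt.
  apply: filterS near_h => h [h0 hd].
  have hv : `|h| * `|v| < d.
    move: hd; rewrite /d1 ltr_pdivlMr ?ltr_wpDl //; apply: le_lt_trans.
    by rewrite ler_wpM2l // lerDl.
  have step (k : 'I_m) : exists2 y, ball x d y &
      f (x + w h k.+1) - f (x + w h k) =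
      (h * v 0 k) * 'D_(basis_vec R k) f y.
    have inball t : `|t| <= `|h * v 0 k| ->
        ball x d (x + w h k + t *: basis_vec R k).
      move=> tk; rewrite -addrA; apply: ball_of; apply: le_lt_trans hv.
      apply: mx_norm_le => [|i j]; first by rewrite mulr_ge0.
      rewrite !mxE ord1 eqxx /=.
      have [-> |ne] := eqVneq j k.
        rewrite ltnn add0r mulr1; apply: le_trans tk _.
        by rewrite normrM ler_wpM2l // mx_coord_le.
      rewrite mulr0 addr0; case: ifP => _; last by rewrite normr0 mulr_ge0.
      by rewrite normrM ler_wpM2l // mx_coord_le.
    have [t tk E] := @mean_value_line R m f (x + w h k) (basis_vec R k) (h * v 0 k)
      (fun t tk => (fU k).1 _ (xd _ (inball t tk)).1).
    exists (x + w h k + t *: basis_vec R k); first exact: inball.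
    rewrite -E; congr (f _ - _); rewrite -addrA; congr (_ + _).
    apply/rowP => i; rewrite !mxE eqxx /= ltnS leq_eqVlt.
    have [-> |ne] := eqVneq i k; first by rewrite eqxx ltnn mulr1 add0r.
    rewrite mulr0 addr0 (_ : (i == k :> nat) = false) //.
    by apply: contraNF ne => /eqP ?; apply/eqP/val_inj.
  have tele : f (x + h *: v) - f x =
      \sum_(k < m) (f (x + w h k.+1) - f (x + w h k)).
    rewrite -(big_mkord xpredT (fun k => f (x + w h k.+1) - f (x + w h k))).
    rewrite telescope_sumr //; congr (f (_ + _) - f _).
      by apply/rowP => i; rewrite !mxE ltn_ord.
    rewrite -[LHS]addr0; congr (_ + _).
    by apply/rowP => i; rewrite !mxE.
  rewrite /= [h *: v + x]addrC tele.
  have [y yd stepE] : exists2 y : 'I_m -> 'rV[R]_m, (forall k, ball x d (y k)) &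
      forall k : 'I_m, f (x + w h k.+1) - f (x + w h k) =
        (h * v 0 k) * 'D_(basis_vec R k) f (y k).
    have [y Hy] := choice (fun k => let: ex_intro2 y a b := step k in
                             ex_intro _ y (conj a b)).
    by exists y => k; have [] := Hy k.
  under eq_bigr do rewrite stepE -mulrA.
  rewrite -big_distrr /= [_ *: _]mulrA mulVf // mul1r /l -sumrB.
  apply: le_trans (ler_norm_sum _ _ _) _.
  apply: (@le_trans _ _ (\sum_i `|v 0 i| * e1)).
    apply: ler_sum => i _; rewrite -mulrBr normrM ler_wpM2l //.
    by have [_] := xd _ (yd i).
  rewrite -big_distrl /= /e1 mulrCA ler_piMr ?(ltW eps0) //.
  by rewrite ler_pdivrMr // mul1r /S lerDl.
by apply: DeriveDef; [apply: cvgP cvg_l | apply: cvg_lim cvg_l].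
Unshelve. all: by end_near. Qed.

(* If [q] were positive, [psi] would be positive just after 0 and [phi] would
   increase there. *)
Lemma second_derivative_at_max (R : realType) (phi psi : R -> R) (d q : R) :
  0 < d -> (forall t : R, `|t| < d -> is_derive t 1 phi (psi t)) ->
  is_derive (0 : R) 1 psi q -> (forall t, phi t <= phi 0) -> psi 0 = 0 /\ q <= 0.
Proof.
move=> d0 dphi dpsi mx.
have phi0 : is_derive (0 : R) 1 phi 0.
  apply: (@derive1_at_max _ phi (- d) d).
  - by rewrite ge0_cp // ltW.
  - by move=> t; rewrite in_itv /= -ltr_norml => /dphi[].
  - by rewrite in_itv /= oppr_lt0 d0.
  - by move=> t _; apply: mx.
have psi0 : psi 0 = 0.
  have n0 : `|0 : R| < d by rewrite normr0.
  by have [_ <-] := dphi 0 n0; apply: derive_val.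
split=> //; rewrite leNgt; apply/negP => q0.
have : h^-1 *: ((psi \o shift 0) (h *: 1) - psi 0) @[h --> 0^'] --> q.
  by have [+ <-] := dpsi.
move/cvgrPdist_lt/(_ _ q0); rewrite psi0.
move=> /nbhs_ballP[e /= e0 eq].
(* Halving keeps [0, a] inside both the interval where [psi] is the derivative of [phi] and the
   radius where psi(t)/t is positive. *)
pose a := Num.min d e / 2.
have a0 : 0 < a by rewrite divr_gt0 // lt_min d0 e0.
have ad : a < d.
  by rewrite /a ltr_pdivrMr // (@le_lt_trans _ _ d) ?ge_min ?lexx // ltr_pMr ?ltr1n.
have ae : a < e.
  rewrite /a ltr_pdivrMr // (@le_lt_trans _ _ e) ?ge_min ?lexx ?orbT //.
  by rewrite ltr_pMr ?ltr1n.
have psi_pos (t : R) : t \in `]0, a[%R -> 0 < psi t.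
  rewrite in_itv /= => /andP[t0 ta].
  have := eq t; rewrite -ball_normE /= sub0r normrN gtr0_norm // (lt_trans ta) //.
  move=> /(_ isT); rewrite gt_eqF // => /(_ isT).
  rewrite [_%:A]mulr1 addr0 subr0 ltr_norml => /andP[_].
  by rewrite gtrBl pmulr_rgt0 ?invr_gt0.
have dphi' (t : R) : t \in `]0, a[%R -> is_derive t 1 phi (psi t).
  rewrite in_itv /= => /andP[t0 ta]; apply: dphi.
  by rewrite gtr0_norm // (lt_trans ta).
have cphi : {within `[0, a], continuous phi}.
  apply: derivable_within_continuous => t; rewrite in_itv /= => /andP[t0 ta].
  by have [] := dphi t; rewrite // ger0_norm // (le_lt_trans ta).
have [c /psi_pos c0 E] := MVT a0 dphi' cphi.
have := mx a; rewrite leNgt => /negP; apply.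
by rewrite -subr_gt0 E subr0 mulr_gt0.
Qed.

Lemma Cinfty_on_partial (R : realType) (m : nat) (U : set 'rV[R]_m) f i :
  Cinfty_on U f -> Cinfty_on U (fun y => 'D_(basis_vec R i) f y).
Proof. by move=> fU k; have [_ /(_ i)[]] := fU k.+1. Qed.

(** Each restriction of f - g to a line through x is maximal at x, and its second derivative there
    is the Hessian form in that direction; the axes give the equality of gradients. *)
Lemma smooth_max_second_order (R : realType) (m : nat) (U : set 'rV[R]_m)
    (f g : 'rV[R]_m -> R) (x : 'rV[R]_m) :
  open U -> U x -> Cinfty_on U f -> Cinfty_on U g ->
  (forall y, f y - g y <= f x - g x) ->
  (forall i, 'D_(basis_vec R i) f x = 'D_(basis_vec R i) g x) /\
  (forall v : 'rV[R]_m, \sum_i \sum_j v 0 i * v 0 j *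
      ('D_(basis_vec R i) (fun y => 'D_(basis_vec R j) f y) x -
       'D_(basis_vec R i) (fun y => 'D_(basis_vec R j) g y) x) <= 0).
Proof.
move=> oU Ux fU gU mx.
pose e i := basis_vec R (i : 'I_m).
have line (v : 'rV[R]_m) :
    \sum_j v 0 j * 'D_(e j) f x - \sum_j v 0 j * 'D_(e j) g x = 0 /\
    \sum_j v 0 j * (\sum_i v 0 i * 'D_(e i) (fun y => 'D_(e j) f y) x) -
    \sum_j v 0 j * (\sum_i v 0 i * 'D_(e i) (fun y => 'D_(e j) g y) x) <= 0.
  have : \forall y \near x, U y by apply: open_nbhs_nbhs.
  move=> /nbhs_ballP[d /= d0 xd].
  pose d1 := d / (`|v| + 1); have d10 : 0 < d1 by rewrite divr_gt0 // ltr_wpDl.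
  have inU (t : R) : `|t| < d1 -> U (x + t *: v).
    move=> td; apply: xd; rewrite -ball_normE /= opprD addrA subrr sub0r normrN.
    rewrite normrZ; move: td; rewrite /d1 ltr_pdivlMr ?ltr_wpDl //.
    by apply: le_lt_trans; rewrite ler_wpM2l // lerDl.
  have dline (h : 'rV[R]_m -> R) (t : R) : Ck_on 1 U h -> `|t| < d1 ->
      is_derive t 1 (fun s : R => h (x + s *: v))
        (\sum_j v 0 j * 'D_(e j) h (x + t *: v)).
    move=> hU td; apply: is_derive_along.
    by apply: is_derive_partials oU (inU _ td) hU.
  pose psi h (t : R) := \sum_j v 0 j * 'D_(e j) h (x + t *: v).
  have dpsi h : Cinfty_on U h -> is_derive (0 : R) 1 (psi h)
      (\sum_j v 0 j * (\sum_i v 0 i * 'D_(e i) (fun y => 'D_(e j) h y) x)).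
    move=> hU; have -> : psi h = \sum_(j < m)
        (v 0 j \*: (fun t : R => 'D_(e j) h (x + t *: v))).
      by apply: funext => t; rewrite fct_sumE.
    apply: is_derive_sum => j; apply: is_deriveZ.
    have := dline (fun y => 'D_(e j) h y) 0 (Cinfty_on_partial j hU 1).
    by rewrite normr0 scale0r addr0; apply.
  have := @second_derivative_at_max R
    (fun t => f (x + t *: v) - g (x + t *: v)) (fun t => psi f t - psi g t) d1 _ d10.
  rewrite /= /psi !scale0r !addr0; apply.
  - by move=> t td; apply: is_deriveB; apply: dline.
  - by apply: is_deriveB; apply: dpsi.
  - by move=> t; apply: mx.
split=> [i|v].
  have [+ _] := line (e i); move/eqP; rewrite subr_eq0 => /eqP.
  have pick (F : 'I_m -> R) : \sum_j e i 0 j * F j = F i.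
    rewrite (bigD1 i) //= big1 => [|j ji]; rewrite mxE ?eqxx ?mul1r ?addr0 //.
    by rewrite (negbTE ji) andbF mul0r.
  by rewrite !pick.
have [_] := line v; rewrite -sumrB; apply: le_trans.
rewrite exchange_big /= le_eqVlt; apply/orP; left; apply/eqP.
apply: eq_bigr => j _; rewrite -mulrBr -sumrB big_distrr /=.
by apply: eq_bigr => i _; rewrite -mulrBr mulrCA mulrA.
Qed.

(** * Pointwise algebra of real (1,1)-forms *)

Section Form11.
Variables (R : realType) (m : nat) (J : 'M[R]_m).
Hypothesis JJ : J *m J = - 1%:M.

Lemma form11D A B : form11 J A -> form11 J B -> form11 J (A + B).
Proof.
move=> /(form11P _ JJ)[A1 A2] /(form11P _ JJ)[B1 B2]; apply/(form11P _ JJ).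
by rewrite linearD /= A1 B1 opprD mulmxDr mulmxDl A2 B2.
Qed.

Lemma form11Z (c : R) A : form11 J A -> form11 J (c *: A).
Proof.
move=> /(form11P _ JJ)[A1 A2]; apply/(form11P _ JJ).
by rewrite linearZ /= A1 scalerN -scalemxAr -scalemxAl A2.
Qed.

Lemma form11B A B : form11 J A -> form11 J B -> form11 J (A - B).
Proof. by move=> fA fB; rewrite -scaleN1r; apply/form11D/form11Z. Qed.

Lemma part11_form11 Om : Om^T = - Om -> form11 J (part11 J Om).
Proof.
move=> OmN; apply: form11Z; apply/(form11P _ JJ); split.
  by rewrite linearD /= !trmx_mul trmxK OmN mulNmx mulmxN mulmxA opprD.
rewrite mulmxDr mulmxDl addrC; congr (_ + _).
rewrite !mulmxA -trmx_mul JJ linearN /= trmx1 !mulNmx mul1mx.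
by rewrite -mulmxA JJ mulmxN mulmx1 opprK.
Qed.

(** The value at (X, J X) is H(X, X) + H(J X, J X): taking the (1,1)-part symmetrises the real
    Hessian under [J]. *)
Lemma part11_hessian_ge0 (H : 'M[R]_m) :
  (forall v : 'cV[R]_m, 0 <= (v^T *m H *m v) 0 0) ->
  forall X : 'cV[R]_m,
    0 <= (X^T *m part11 J ((H *m J)^T - H *m J) *m (J *m X)) 0 0.
Proof.
move=> Hpos X; set Y := J *m X.
have JY : J *m Y = - X by rewrite mulmxA JJ mulNmx mul1mx.
have XJ : X^T *m J^T = Y^T by rewrite trmx_mul.
have YJ : Y^T *m J^T = - X^T by rewrite -trmx_mul JY linearN.
have JX : J *m X = Y by []; clearbody Y.
suff -> : X^T *m part11 J ((H *m J)^T - H *m J) *m Y =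
    2^-1 *: ((X^T *m H *m X) + (X^T *m H *m X)^T +
             (Y^T *m H *m Y) + (Y^T *m H *m Y)^T).
  rewrite mxE mulr_ge0 ?invr_ge0 ?ler0n // !mxE.
  by have := Hpos X; have := Hpos Y; rewrite !mxE => y0 x0; rewrite !addr_ge0.
rewrite /part11 -scalemxAr -scalemxAl; congr (_ *: _).
have tr2 (Z : 'cV[R]_m) : (Z^T *m H *m Z)^T = Z^T *m H^T *m Z.
  by rewrite !trmx_mul trmxK mulmxA.
set Om := (H *m J)^T - H *m J.
have OmE (Z W : 'cV[R]_m) : Z^T *m Om *m W =
    Z^T *m J^T *m H^T *m W - Z^T *m H *m (J *m W).
  by rewrite /Om trmx_mul mulmxBr mulmxBl !mulmxA.
rewrite mulmxDr mulmxDl OmE XJ JY mulmxN opprK.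
have -> : X^T *m (J^T *m Om *m J) *m Y = - (Y^T *m Om *m X).
  by rewrite !mulmxA XJ -[_ *m J *m Y]mulmxA JY mulmxN.
rewrite OmE YJ !tr2 !mulNmx.
rewrite JX; move: (X^T *m H *m X) (Y^T *m H *m Y) => a b.
move: (X^T *m H^T *m X) (Y^T *m H^T *m Y) => a' b'.
by apply/matrixP => i j; rewrite !mxE; ring.
Qed.

Lemma part10_covector10 (al : 'rV[R]_m) : covector10 J (part10 J al).
Proof.
move=> X JX; rewrite /part10 -mulmxA /proj10 -scalemxAl mulmxBl mul1mx.
rewrite -scalemxAl JX scalerA mulrN I_C2 opprK scale1r subrr.
by rewrite scaler0 mulmx0.
Qed.

End Form11.

(** * Second derivatives in charts *)

Section Charts.
Variables (R : realType) (m : nat) (M : smooth_manifold R m).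
Implicit Types (u w : M -> R) (a : midx M) (p : M).

Lemma cmap_img a p : mdom a p -> (cmap (atlas a) @` mdom a) (cmap (atlas a) p).
Proof. by move=> ap; exists p. Qed.

Lemma cinvK a x :
  (cmap (atlas a) @` mdom a) x -> cmap (atlas a) (cinv (atlas a) x) = x.
Proof. by move=> [p ap <-]; rewrite cmapK. Qed.

Lemma near_chart a p : mdom a p ->
  \forall x \near cmap (atlas a) p, (cmap (atlas a) @` mdom a) x.
Proof.
move=> ap; apply: open_nbhs_nbhs; split; last exact: cmap_img.
exact: cimg_open.
Qed.

Lemma smooth_continuous u : smooth u -> continuous u.
Proof.
move=> su p; set a := chart_at p; have ap : mdom a p := chart_at_mem p.
have [cu _] := su a 0%N.
have cc : {for p, continuous ((u \o cinv (atlas a)) \o cmap (atlas a))}.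
  apply: continuous_comp; first exact: cmap_continuous.
  exact: cu (cmap_img ap).
have E : \forall q \near p, ((u \o cinv (atlas a)) \o cmap (atlas a)) q = u q.
  have : \forall q \near p, mdom a q.
    by apply: open_nbhs_nbhs; split => //; exact: cdom_open.
  by apply: filterS => q aq /=; rewrite cmapK.
have {}cc : ((u \o cinv (atlas a)) \o cmap (atlas a)) q @[q --> p] --> u p.
  have gp : u p = ((u \o cinv (atlas a)) \o cmap (atlas a)) p by rewrite /= cmapK.
  by rewrite gp; exact: cc.
by apply: cvg_trans cc; apply: near_eq_cvg.
Qed.

Definition hess u a p : 'M[R]_m :=
  \matrix_(i, j) 'D_(basis_vec R i)
    (fun y => 'D_(basis_vec R j) (u \o cinv (atlas a)) y) (cmap (atlas a) p).

(** The product rule separates the Hessian term from the derivatives of [J], which are multiplied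
    only by du. *)
Lemma pd_Jdu (J : components M 'M[R]_m) u a p i j :
  is_almost_complex J -> smooth u -> mdom a p ->
  pd a i (fun q => Jform1 J (du u) a q 0 j) p =
  - ((hess u a p *m J a p) i j +
     \sum_k du u a p 0 k * pd a i (fun q => J a q k j) p).
Proof.
move=> [sJ _ _] su ap; rewrite /pd.
set x := cmap (atlas a) p; set U := cmap (atlas a) @` mdom a.
have Ux : U x by exact: cmap_img.
pose ut := u \o cinv (atlas a).
pose Jt k := (fun q => J a q k j) \o cinv (atlas a).
have dD k : is_derive x (basis_vec R i) (fun y => 'D_(basis_vec R k) ut y)
    ('D_(basis_vec R i) (fun y => 'D_(basis_vec R k) ut y) x).
  apply: derivableP; have := Cinfty_on_partial k (su a) 1%N.
  by move=> [_ /(_ i)[+ _]]; apply.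
have dJ k : is_derive x (basis_vec R i) (Jt k) ('D_(basis_vec R i) (Jt k) x).
  apply: derivableP; have := sJ a k j 1%N.
  by move=> [_ /(_ i)[+ _]]; apply.
transitivity ('D_(basis_vec R i)
    (- \sum_(k < m) ((fun y => 'D_(basis_vec R k) ut y) * Jt k)) x).
  apply: near_eq_derive; have := near_chart ap; apply: filterS => y Uy.
  rewrite /= /Jform1 !mxE fctE; congr (- _); rewrite fct_sumE.
  by apply: eq_bigr => k _; rewrite !mxE /pd cinvK.
have dsum : is_derive x (basis_vec R i)
    (- \sum_(k < m) ((fun y => 'D_(basis_vec R k) ut y) * Jt k))
    (- \sum_(k < m) ('D_(basis_vec R k) ut x *: 'D_(basis_vec R i) (Jt k) x +
       Jt k x *: 'D_(basis_vec R i) (fun y => 'D_(basis_vec R k) ut y) x)).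
  by apply: is_deriveN; apply: is_derive_sum => k; apply: is_deriveM.
rewrite derive_val !mxE -big_split /=; congr (- _); apply: eq_bigr => k _.
rewrite !mxE /pd /Jt /= cmapK // addrC; congr (_ + _).
by rewrite [LHS]mulrC.
Qed.

(** Equal differentials cancel every term containing a derivative of [J] (collected in [K]), so only
    the Hessians survive even for non-integrable [J]. *)
Lemma iddbar_sub (J : components M 'M[R]_m) u w a p :
  is_almost_complex J -> smooth u -> smooth w -> mdom a p ->
  du u a p = du w a p ->
  iddbar J u a p - iddbar J w a p =
  2^-1 *: part11 (J a p) (((hess u a p - hess w a p) *m J a p)^T -
                          (hess u a p - hess w a p) *m J a p).
Proof.
move=> JC su sw ap duw; rewrite /iddbar -scalerBr; congr (_ *: _).
rewrite /part11 -scalerBr; congr (_ *: _).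
rewrite opprD addrACA -mulmxBl -mulmxBr.
suff -> : dform1 (Jform1 J (du u)) a p - dform1 (Jform1 J (du w)) a p =
  ((hess u a p - hess w a p) *m J a p)^T - (hess u a p - hess w a p) *m J a p.
  by [].
pose K (d : 'rV[R]_m) : 'M[R]_m := \matrix_(i, j)
  (\sum_k d 0 k * pd a j (fun q => J a q k i) p -
   \sum_k d 0 k * pd a i (fun q => J a q k j) p).
have E v : smooth v -> dform1 (Jform1 J (du v)) a p =
    (hess v a p *m J a p)^T - hess v a p *m J a p + K (du v a p).
  move=> sv; apply/matrixP => i j; rewrite [LHS]mxE !pd_Jdu //.
  move: (hess v a p *m J a p) (du v a p) => A d.
  by rewrite !mxE; ring.
have alg (A B k : 'M[R]_m) :
    (A^T - A + k) - (B^T - B + k) = (A - B)^T - (A - B).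
  by apply/matrixP => i j; rewrite !mxE; ring.
by rewrite (E _ su) (E _ sw) duw alg mulmxBl.
Qed.
End Charts.

Lemma iddbar_form11 (R : realType) (m : nat) (M : smooth_manifold R m)
    (J : components M 'M[R]_m) (u : M -> R) (a : midx M) (p : M) :
  is_almost_complex J -> mdom a p -> form11 (J a p) (iddbar J u a p).
Proof.
move=> [_ _ JJ] ap; apply: form11Z; first exact: JJ.
apply: part11_form11; first exact: JJ.
by apply/matrixP => i j; rewrite !mxE opprB.
Qed.

Lemma iddbar_max_principle (R : realType) (m : nat) (M : smooth_manifold R m)
    (J : components M 'M[R]_m) (u0 u : M -> R) :
  compact [set: M] -> [set: M] !=set0 -> is_almost_complex J ->
  smooth u0 -> smooth u ->
  exists q : M, let a := chart_at q in
    du u a q = du u0 a q /\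
    forall X : 'cV[R]_m,
      0 <= (X^T *m (iddbar J u a q - iddbar J u0 a q) *m (J a q *m X)) 0 0.
Proof.
move=> cM M0 JC su0 su; have [_ _ JJ] := JC.
have cont : {within [set: M], continuous (fun p => u0 p - u p)}.
  apply: continuous_subspaceT => p.
  by apply: continuousB; apply: smooth_continuous.
have [q _ qmax] := compact_EVT_max M0 cM cont.
exists q => a; have aq : mdom a q := chart_at_mem q.
(* [cinv] is total with values in M, so maximality over M gives this for every y, also outside the
   chart image. *)
have chart_max y :
    (u0 \o cinv (atlas a)) y - (u \o cinv (atlas a)) y <=
    (u0 \o cinv (atlas a)) (cmap (atlas a) q) -
    (u \o cinv (atlas a)) (cmap (atlas a) q).
  by rewrite /= cmapK //; apply: qmax; rewrite inE.
have [D1 D2] := smooth_max_second_order (@cimg_open _ _ _ (atlas a))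
  (cmap_img aq) (su0 a) (su a) chart_max.
have duE : du u a q = du u0 a q.
  by apply/rowP => i; rewrite !mxE /pd D1.
split=> // X; rewrite iddbar_sub // -scalemxAr -scalemxAl mxE mulr_ge0 ?invr_ge0 //.
apply: part11_hessian_ge0 => [|v]; first exact: JJ.
have := D2 v^T; set S := \sum_i _ => S0.
suff -> : (v^T *m (hess u a q - hess u0 a q) *m v) 0 0 = - S by rewrite oppr_ge0.
rewrite /S mxE exchange_big -sumrN /=; apply: eq_bigr => j _.
rewrite mxE mulr_suml -sumrN; apply: eq_bigr => i _.
by rewrite !mxE -mulrN opprB mulrAC.
Qed.

(** * The infimum formula *)

(** For [u0] the weighted function is the constant e^c, so [u0] attains the value, and one
    comparison point per competitor bounds its supremum from below. *)
Lemma ereal_inf_supM (R : realType) (m : nat) (M : smooth_manifold R m)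
    (psi : M -> R) (c : R) (F : (M -> R) -> M -> R) (A : set (M -> R))
    (u0 : M -> R) :
  [set: M] !=set0 -> A u0 -> (forall p, F u0 p = expR (psi p + c)) ->
  (forall u, A u -> exists q, F u0 q <= F u q) ->
  (expR c)%:E = ereal_inf [set supM (fun p => expR (- psi p) * F u p) | u in A].
Proof.
move=> [p0 _] Au0 F0 comp.
have F0c p : expR (- psi p) * F u0 p = expR c by rewrite F0 -expRD addKr.
apply/eqP; rewrite eq_le; apply/andP; split.
  apply: le_ereal_inf_tmp => _ [u Au <-]; have [q Fq] := comp u Au.
  apply: (@le_trans _ _ (expR (- psi q) * F u q)%:E).
    by rewrite lee_fin -(F0c q) ler_wpM2l ?expR_ge0.
  by apply: ereal_sup_ubound; exists q.
apply: (@le_trans _ _ (supM (fun p => expR (- psi p) * F u0 p))).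
  by apply: ereal_inf_lbound; exists u0.
by apply: ge_ereal_sup => _ [p _ <-]; rewrite F0c.
Qed.

(** The supremum over an empty manifold is -oo, so the normalisation supplies the point needed for a
    maximum to exist. *)
Lemma supM0_nonempty (R : realType) (m : nat) (M : smooth_manifold R m)
    (u : M -> R) : supM u = 0%:E -> [set: M] !=set0.
Proof.
move=> s0; apply/set0P/eqP => M0; move: s0.
by rewrite /supM M0 image_set0 ereal_sup0.
Qed.

Lemma laplC_sub (R : realType) (n : nat) (M : smooth_manifold R (n + n))
    (J chi : components M 'M[R]_(n + n)) (u w : M -> R) (p : M) : (0 < n)%N ->
  let a := chart_at p in
  laplC J chi u p - laplC J chi w p =
  n%:R * (mixed_top 1 (iddbar J u a p - iddbar J w a p) (chi a p) /
          mixed_top n (chi a p) (chi a p)).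
Proof. by move=> n0 a; rewrite mixed_top1B // mulrBl mulrBr. Qed.

Lemma form11_partial (R : realType) (m : nat) (M : smooth_manifold R m)
    (J : components M 'M[R]_m) (Z : components M ('rV[R[i]]_m -> 'M[R]_m))
    (u : M -> R) (a : midx M) (p : M) :
  is_linear_form11 J Z -> mdom a p ->
  form11 (J a p) (Z a p (partial J u a p)).
Proof.
by move=> [_ Z11 _ _] ap; apply: Z11 => //; apply: part10_covector10.
Qed.

Theorem theorem1p3 (R : realType) (n : nat) (M : smooth_manifold R (n + n))
    (J chi : components M 'M[R]_(n + n)) (psi : M -> R)
    (compactM : compact [set: M])
    (J_ac : is_almost_complex J)
    (chi_metric : is_hermitian_metric J chi)
    (psi_smooth : smooth psi) :
  (forall (eta : components M 'M[R]_(n + n))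
          (W : components M ('rV[R[i]]_(n + n) -> 'M[R]_(n + n)))
          (u0 : M -> R) (c : R),
     (2 <= n)%N ->
     is_hermitian_metric J eta ->
     is_linear_form11 J W ->
     smooth u0 ->
     wedge_eq chi n (eta_form J chi eta W u0) (fun p => expR (psi p + c)) ->
     is_positive J (eta_form J chi eta W u0) ->
     supM u0 = 0%:E ->
     (expR c)%:E =
       ereal_inf
         [set supM (fun p =>
                expR (- psi p) * wedge_quot chi n (eta_form J chi eta W u) p)
         | u in [set u : M -> R |
                  smooth u /\ is_positive J (eta_form J chi eta W u)]])
  /\
  (forall (k : nat) (omega : components M 'M[R]_(n + n))
          (Z : components M ('rV[R[i]]_(n + n) -> 'M[R]_(n + n)))
          (u0 : M -> R) (c : R),
     (1 <= k <= n)%N ->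
     is_form11 J omega ->
     k_positive chi k omega ->
     is_linear_form11 J Z ->
     smooth u0 ->
     wedge_eq chi k (omega_form J omega Z u0) (fun p => expR (psi p + c)) ->
     k_positive chi k (omega_form J omega Z u0) ->
     supM u0 = 0%:E ->
     (expR c)%:E =
       ereal_inf
         [set supM (fun p =>
                expR (- psi p) * wedge_quot chi k (omega_form J omega Z u) p)
         | u in [set u : M -> R |
                  smooth u /\ k_positive chi k (omega_form J omega Z u)]]).
Proof.
have [[_ _ chi11] chipos] := chi_metric; have [_ _ JJ] := J_ac.
have quot k Om (f : M -> R) : wedge_eq chi k Om f ->
    forall p, wedge_quot chi k Om p = f p.
  move=> Omf p; have ap : mdom (chart_at p) p := chart_at_mem p.
  rewrite /wedge_quot Omf // mulfK //.
  exact: mixed_top_metric_neq0 (JJ _ _ ap) (chi11 _ _ ap) (chipos _ _ ap).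
split=> [eta W u0 c n2 [[_ _ eta11] etapos] W11 su0 eq0 pos0 sup0|
         k omega Z u0 c /andP[k1 kn] [_ _ omega11] _ Z11 su0 eq0 pos0 sup0].
  have M0 := supM0_nonempty sup0; have n0 : (0 < n)%N := ltnW n2.
  apply: (@ereal_inf_supM _ _ _ psi c
    (fun u => wedge_quot chi n (eta_form J chi eta W u)) _ u0) => //.
    exact: quot.
  move=> u [su pos].
  have [q [duE ge0]] := iddbar_max_principle compactM M0 J_ac su0 su.
  exists q; set a := chart_at q in duE ge0 *.
  have aq : mdom a q := chart_at_mem q.
  have eta11u w : form11 (J a q) (eta_form J chi eta W w a q).
    have JJq := JJ _ _ aq.
    apply: form11D => //; last exact: form11_partial.
    apply: form11D => //; first exact: eta11.
    apply: form11Z => //; apply: form11B => //; last exact: iddbar_form11.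
    by apply: form11Z => //; exact: chi11.
  apply: (mixed_top_quot_mono (leqnn n) (JJ _ _ aq) (chi11 _ _ aq) (chipos _ _ aq)
    (eta11u u0) (eta11u u)).
    have N11 : form11 (J a q) (iddbar J u a q - iddbar J u0 a q).
      by apply: form11B; [exact: JJ | exact: iddbar_form11 | exact: iddbar_form11].
    (* With N the difference of the two complex Hessians, its trace is the difference of the
       Laplacians by linearity. *)
    have tr := trace_form_ge0 (JJ _ _ aq) (chi11 _ _ aq) (chipos _ _ aq) n0 N11 ge0.
    move=> X; suff -> : eta_form J chi eta W u a q - eta_form J chi eta W u0 a q =
        (n%:R - 1)^-1 *: ((laplC J chi u q - laplC J chi u0 q) *: chi a q -
          (iddbar J u a q - iddbar J u0 a q)).
      rewrite laplC_sub // -scalemxAr -scalemxAl mxE mulr_ge0 ?tr //.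
      by rewrite invr_ge0 subr_ge0 ler1n.
    (* The (1,0)-covectors agree at [q], so the two values of [W] coincide and cancel. *)
    rewrite /eta_form /partial duE.
    move: (iddbar _ _ _ _) (iddbar _ _ _ _) => i i0.
    move: (W a q _) (laplC _ _ _ _) (laplC _ _ _ _) => w l l0.
    by apply/matrixP => x y; rewrite !mxE; ring.
  move=> i /andP[_ i_n].
  exact: (mixed_top_quot_gt0 (JJ _ _ aq) (chi11 _ _ aq) (chipos _ _ aq)
    (eta11u u0) (pos0 _ _ aq) i_n).
have M0 := supM0_nonempty sup0.
apply: (@ereal_inf_supM _ _ _ psi c
  (fun u => wedge_quot chi k (omega_form J omega Z u)) _ u0) => //.
  exact: quot.
move=> u [su pos].
have [q [duE ge0]] := iddbar_max_principle compactM M0 J_ac su0 su.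
exists q; set a := chart_at q in duE ge0 *.
have aq : mdom a q := chart_at_mem q.
have omega11u w : form11 (J a q) (omega_form J omega Z w a q).
  have JJq := JJ _ _ aq.
  apply: form11D => //; last exact: form11_partial.
  by apply: form11D => //; [exact: omega11 | exact: iddbar_form11].
apply: (mixed_top_quot_mono kn (JJ _ _ aq) (chi11 _ _ aq) (chipos _ _ aq)
  (omega11u u0) (omega11u u)).
  move=> X; suff -> : omega_form J omega Z u a q - omega_form J omega Z u0 a q =
      iddbar J u a q - iddbar J u0 a q by exact: ge0.
  rewrite /omega_form /partial duE.
  move: (omega a q) (Z a q _) (iddbar _ _ _ _) (iddbar _ _ _ _) => w z i i0.
  by apply/matrixP => x y; rewrite !mxE; ring.
by move=> i ik; apply: (pos0 i ik q).
Qed.
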